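(* Let $\ell\ge r\ge 3$ be integers. There exists a constant $C_\ell>0$, depending only on $\ell$, such that the following holds. Let $n$ be an integer with $n\ge 10^{20}\ell^{20}$, let $\varepsilon$ be a real number with $\varepsilon\le n^{1/\ell-1}$, and let $\mathcal{H}$ be a $\mathcal{K}_{\ell+1}^r$-saturated $r$-graph on $n$ vertices with \[|\mathcal{H}|\ge t_r(n,\ell)-\frac{\binom{\ell}{r}r\varepsilon}{4(\ell-1)\ell^{r-1}}n^r.\] Then $\mathcal{H}$ contains, as a subgraph, a complete $\ell$-partite $r$-graph on at least $\left(1-C_\ell\varepsilon n^{1-1/\ell}-10^6\ell^3(3r-4)^3\varepsilon\right)n$ vertices.
   Context: An $r$-graph is a set of vertices with a collection of $r$-element subsets (edges); $|\mathcal{H}|$ is the number of edges. For integers $\ell\ge r\ge 2$, $\mathcal{K}_{\ell+1}^r$ is the family of all $r$-graphs $F$ with at most $\binom{\ell+1}{2}$ edges such that for some $(\ell+1)$-set $S$ of vertices, every pair $\{u,v\}\subset S$ is contained in some edge of $F$. An $r$-graph $\mathcal{H}$ is $\mathcal{K}_{\ell+1}^r$-saturated if it contains no member of $\mathcal{K}_{\ell+1}^r$ as a subgraph, but adding any new $r$-set as an edge creates a subgraph isomorphic to a member of $\mathcal{K}_{\ell+1}^r$. A complete $\ell$-partite $r$-graph on a vertex set $U$ with partition $U=U_1\cup\dots\cup U_\ell$ has as edges all $r$-subsets of $U$ meeting each $U_i$ in at most one vertex. $T_r(n,\ell)$ is the complete $\ell$-partite $r$-graph on $n$ vertices whose part sizes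 differ by at most one, and $t_r(n,\ell)$ is its number of edges. *)

(* Defs.v *)
From mathcomp Require Import all_boot.

Set Implicit Arguments.
Unset Strict Implicit.
Unset Printing Implicit Defensive.

(* The vertex set of a hypergraph is a whole finite type V; a hypergraph is
   identified with its set of edges, so |H| is #|H|. *)

Definition is_rgraph (r : nat) (V : finType) (H : {set {set V}}) : Prop :=
  forall e, e \in H -> #|e| = r.

Definition contains_copy (V W : finType) (H : {set {set V}})
    (F : {set {set W}}) : Prop :=
  exists2 f : W -> V, injective f & forall e, e \in F -> f @: e \in H.

(* K_family r l.+1 is the family K_{l+1}^r. *)
Definition K_family (r k : nat) (W : finType) (F : {set {set W}}) : Prop :=
  [/\ is_rgraph r F,
      #|F| <= 'C(k, 2) &
      exists S : {set W}, #|S| = k /\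
        forall u v, u \in S -> v \in S -> u != v ->
          exists e, [/\ e \in F, u \in e & v \in e]].

Definition contains_K_member (r k : nat) (V : finType) (H : {set {set V}}) :
    Prop :=
  exists (W : finType) (F : {set {set W}}), K_family r k F /\ contains_copy H F.

Definition K_saturated (r k : nat) (V : finType) (H : {set {set V}}) : Prop :=
  ~ contains_K_member r k H /\
  forall e : {set V}, #|e| = r -> e \notin H -> contains_K_member r k (e |: H).

Definition complete_partite (r l : nat) (V : finType) (P : 'I_l -> {set V}) :
    {set {set V}} :=
  [set e : {set V} | [&& #|e| == r, e \subset \bigcup_i P i
                       & [forall i, #|e :&: P i| <= 1]]].

(* The parts are required to be nonempty: since "subgraph" does not mean
   "induced subgraph", allowing empty parts would make every vertex set carry
   the edgeless "complete l-partite" r-graph with a single nonempty part. *)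
Definition is_lpartition (l : nat) (V : finType) (U : {set V})
    (P : 'I_l -> {set V}) : Prop :=
  [/\ U = \bigcup_i P i,
      forall i j, i != j -> [disjoint P i & P j] &
      forall i, P i != set0].

Definition contains_complete_partite_on (r l : nat) (V : finType)
    (H : {set {set V}}) (U : {set V}) : Prop :=
  exists P : 'I_l -> {set V},
    is_lpartition U P /\ complete_partite r P \subset H.

(* T_r(n, l) is realised on {0, ..., n-1}, the parts being the residue classes
   modulo l; turan_part_balanced shows that their sizes differ by at most 1. *)
Definition turan_part (n l : nat) (i : 'I_l) : {set 'I_n} :=
  [set x : 'I_n | x %% l == i].

Definition turan_graph (r n l : nat) : {set {set 'I_n}} :=
  complete_partite r (@turan_part n l).

Definition turan_number (r n l : nat) : nat := #|turan_graph r n l|.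

Lemma turan_part_cover (n l : nat) : 0 < l ->
  \bigcup_i @turan_part n l i = [set: 'I_n].
Proof.
move=> l0; apply/setP => x; rewrite !inE; apply/bigcupP.
by exists (Ordinal (ltn_pmod x l0)); rewrite ?inE.
Qed.

Lemma turan_part_disjoint (n l : nat) (i j : 'I_l) :
  i != j -> [disjoint turan_part n i & turan_part n j].
Proof.
move=> ij; rewrite -setI_eq0; apply/eqP/setP => x; rewrite !inE.
apply/negP => /andP[/eqP xi /eqP xj]; case/negP: ij.
by apply/eqP/val_inj; rewrite /= -xi.
Qed.

Lemma turan_part_balanced (n l : nat) (i j : 'I_l) :
  #|turan_part n i| <= (#|turan_part n j|).+1.
Proof.
have l0 : 0 < l by apply: leq_ltn_trans (ltn_ord i).
pose A := [set x in turan_part n i | l <= x].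
have AE : #|turan_part n i| <= #|A|.+1.
  rewrite -(cardsID A (turan_part n i)) -addn1 leq_add //.
    by apply: subset_leq_card; apply: subsetIr.
  apply/card_le1_eqP => x y; rewrite !inE => /andP[+ /eqP xi] /andP[+ /eqP yi].
  rewrite xi yi eqxx /= -!ltnNge => xl yl.
  by apply: val_inj; rewrite /= -(modn_small xl) -(modn_small yl) xi yi.
apply: leq_trans AE _; rewrite ltnS.
have fP (x : 'I_n) : l <= x -> (x %/ l).-1 * l + j < n.
  move=> lx; apply: leq_trans (ltn_ord x); rewrite ltnS.
  apply: leq_trans (leq_divM x l).
  have : 0 < x %/ l by rewrite divn_gt0.
  case: (x %/ l) => // m _ /=.
  by rewrite mulSn addnC leq_add2r ltnW.
pose f (x : 'I_n) : 'I_n := insubd x ((x %/ l).-1 * l + j).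
have fE (x : 'I_n) : l <= x -> val (f x) = (x %/ l).-1 * l + j.
  by move=> lx; rewrite /f val_insubd fP.
rewrite -(@card_in_imset _ _ f A).
  apply: subset_leq_card; apply/subsetP => y /imsetP[x].
  rewrite !inE => /andP[_ lx] ->; rewrite -[nat_of_ord _]/(val (f x)) fE //.
  by rewrite modnMDl modn_small.
move=> x y; rewrite !inE => /andP[/eqP xi lx] /andP[/eqP yi ly] /(congr1 val).
rewrite !fE // => /addIn /eqP; rewrite eqn_pmul2r // => /eqP h.
apply: val_inj; rewrite /= (divn_eq x l) (divn_eq y l) xi yi.
have: 0 < x %/ l by rewrite divn_gt0.
have: 0 < y %/ l by rewrite divn_gt0.
by move: h; case: (x %/ l) => // a; case: (y %/ l) => // b /= ->.
Qed.

(* Main.v *)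
Require Import Defs.
From HB Require Import structures.
From mathcomp Require Import all_boot all_order all_algebra.
From mathcomp Require Import reals exp.
From mathcomp Require Import zify ring lra.

(** Let [G] be the 2-shadow of [H]. Saturation says that [H] is the set of
    [r]-cliques of [G], that [G] has no [l+1]-clique, and that two non-adjacent
    vertices with a common [r-2]-clique have a common [l-1]-clique.

    A weighted version of Zykov's symmetrization with Füredi's error term gives
    an [l]-colouring for which at most [t_r(n,l) - |H|] of the [r]-cliques are
    not rainbow. Hence the colour classes are nearly balanced, only
    [O(eps n^2)] pairs of differently coloured vertices are non-adjacent
    ("missing"), and all vertices outside a set [B] of size [O(eps n)] are in
    at most [n / (4 l (l+1))] missing pairs; outside [B] every edge is
    bicoloured, since otherwise a greedy choice would produce an [l+1]-clique.

    Put [d ~ n^(1/l)]. Deleting the vertices of missing degree above [d] costs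
    [O(eps n^2 / d)] vertices. A missing pair among the rest has a common
    [l-1]-clique, which must use some [b] in [B]; inside the neighbourhood of
    [b] there is no [l]-clique, and all such pairs can be destroyed by deleting
    [O(d^(l-1))] vertices. What remains is complete multipartite, and the total
    loss is [O(eps n * n^(1-1/l))]. *)

Set Implicit Arguments.
Unset Strict Implicit.
Unset Printing Implicit Defensive.
Import Order.TTheory GRing.Theory Num.Theory.

(** * Elementary symmetric functions *)

Lemma setD1_ind (T : finType) (P : {set T} -> Prop) :
  P set0 -> (forall (S : {set T}) x, x \in S -> P (S :\ x) -> P S) ->
  forall S, P S.
Proof.
move=> P0 PD S; move: {2}#|S| (leqnn #|S|) => n.
elim: n S => [|n IH] S; first by rewrite leqn0 cards_eq0 => /eqP ->.
have [-> //|[x xS]] := set_0Vmem S.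
rewrite (cardsD1 x) xS add1n ltnS => Sn.
by apply: PD xS _; apply: IH.
Qed.

(** The elementary symmetric polynomial of degree [k] in the values [a i], [i] in [S], read off as a
    coefficient of its generating polynomial. *)
Definition elsym (I : finType) (S : {set I}) (a : I -> nat) (k : nat) : nat :=
  ((\prod_(i in S) (1 + (a i)%:P * 'X) : {poly nat})`_k)%R.

Section ElementarySymmetric.
Variable I : finType.
Implicit Types (S : {set I}) (a b : I -> nat) (i j : I) (k : nat).

Lemma elsym_set0 a k : elsym set0 a k = (k == 0).
Proof. by rewrite /elsym big_set0 coef1; case: k. Qed.

Lemma elsymD1 S a i k : i \in S ->
  elsym S a k.+1 = elsym (S :\ i) a k.+1 + a i * elsym (S :\ i) a k.
Proof.
move=> iS; rewrite /elsym (big_setD1 i) //= mulrDl mul1r coefD -mulrA coefCM.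
by rewrite coefXM.
Qed.

Lemma elsym0 S a : elsym S a 0 = 1.
Proof.
rewrite /elsym; elim/big_ind: _ => [|p q hp hq|i _]; first by rewrite coef1.
  by rewrite coef0M hp hq.
by rewrite coefD coef1 coefMX.
Qed.

Lemma eq_elsym S a b k : {in S, a =1 b} -> elsym S a k = elsym S b k.
Proof.
move=> ab; rewrite /elsym (eq_bigr (fun i => 1 + (b i)%:P * 'X)%R) //.
by move=> i /ab ->.
Qed.

Lemma leq_elsym S a b k : {in S, forall i, a i <= b i} ->
  elsym S a k <= elsym S b k.
Proof.
elim/setD1_ind: S k => [|S i iS IH] k ab; first by rewrite !elsym_set0.
case: k => [|k]; first by rewrite !elsym0.
have abD : {in S :\ i, forall i, a i <= b i}.
  by move=> j; rewrite !inE => /andP[_ /ab].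
by rewrite !(elsymD1 _ _ iS) leq_add ?leq_mul ?IH ?ab.
Qed.

(** Every product over [k.+1] indices extends one over [k] of them, so it occurs when the right side
    is expanded. *)
Lemma leq_elsymS S a k : elsym S a k.+1 <= (\sum_(i in S) a i) * elsym S a k.
Proof.
elim/setD1_ind: S k => [|S i iS IH] k; first by rewrite !elsym_set0.
rewrite (elsymD1 a k iS) (big_setD1 i) //=.
have := IH k; case: k => [|k]; first by rewrite !elsym0; lia.
by rewrite (elsymD1 a k iS); nia.
Qed.

Lemma elsym_const S q k : elsym S (fun=> q) k = 'C(#|S|, k) * q ^ k.
Proof.
elim/setD1_ind: S k => [|S i iS IH] [|k];
  rewrite ?elsym0 ?bin0 ?elsym_set0 ?cards0 ?bin0n //.
by rewrite (elsymD1 _ _ iS) !IH (cardsD1 i S) iS add1n binS expnS; nia.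
Qed.

(** Terms are sorted by how many of [i], [j] they use. Hence changing [a i] and [a j] with a fixed
    sum acts only through their product. *)
Lemma elsymD2 S a i j k : i \in S -> j \in S -> i != j ->
  elsym S a k.+2 = elsym (S :\ i :\ j) a k.+2
    + (a i + a j) * elsym (S :\ i :\ j) a k.+1
    + a i * a j * elsym (S :\ i :\ j) a k.
Proof.
move=> iS jS ij; have jSi : j \in S :\ i by rewrite !inE eq_sym ij jS.
by rewrite !(elsymD1 _ _ iS) !(elsymD1 _ _ jSi); nia.
Qed.

(** With [s] the sum over the other indices, [leq_elsymS] bounds the three terms of [elsymD2] by
    parts of [(s + a i + a j)^2] times the last factor. This drives both the gain from equalizing
    two classes and the count of [r]-sets through a missing pair. *)
Lemma leq_elsym_pair S a i j k : i \in S -> j \in S -> i != j ->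
  elsym S a k.+2 <= (\sum_(x in S) a x) ^ 2 * elsym (S :\ i :\ j) a k.
Proof.
move=> iS jS ij; have jSi : j \in S :\ i by rewrite !inE eq_sym ij jS.
rewrite (elsymD2 a k iS jS ij) (big_setD1 i iS) (big_setD1 j jSi) /=.
have := leq_elsymS (S :\ i :\ j) a k; have := leq_elsymS (S :\ i :\ j) a k.+1.
set s := \sum_(_ in _) _; set T := _ :\ _ :\ _.
move: (elsym T a k.+2) (elsym T a k.+1) (elsym T a k) => u v w.
move=> uv vw; have us : u <= s * (s * w) by apply: leq_trans uv _; rewrite leq_mul.
have : (a i + a j) * v <= (a i + a j) * (s * w) by rewrite leq_mul.
by nia.
Qed.

(* Moving one unit from an index where [a] exceeds [q] to one where it falls
   short does not decrease [elsym], since balancedness of [q] makes the former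
   value larger. *)
Lemma leq_elsym_balanced S a q k : \sum_(i in S) a i = \sum_(i in S) q i ->
  {in S &, forall i j, q i <= (q j).+1} -> elsym S a k.+2 <= elsym S q k.+2.
Proof.
move=> aq qb.
(* Induction on the total excess of [a] over [q]; subtraction is truncated, so zero excess means
   [a <= q] everywhere. *)
move: {2}(\sum_(i in S) (a i - q i)) (leqnn (\sum_(i in S) (a i - q i))) => n.
elim: n a aq => [|n IH] a aq.
  rewrite leqn0 sum_nat_eq0 => /forall_inP le0; apply: leq_elsym => i iS.
  by rewrite -subn_eq0; apply: le0.
move=> an; have [/forall_inP le|] := boolP [forall (i | i \in S), a i <= q i].
  exact: leq_elsym.
rewrite negb_forall_in => /exists_inP[i iS]; rewrite -ltnNge => qai.
have [/forall_inP ge|] := boolP [forall (j | j \in S), q j <= a j].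
  have : \sum_(i in S) q i < \sum_(i in S) a i.
    rewrite (big_setD1 i iS) [ltnRHS](big_setD1 i iS) /=.
    rewrite -addSn leq_add //; apply: leq_sum => j.
    by rewrite !inE => /andP[_ /ge].
  by rewrite aq ltnn.
rewrite negb_forall_in => /exists_inP[j jS]; rewrite -ltnNge => aqj.
have ij : i != j by apply/eqP => ij; move: qai aqj; rewrite ij; lia.
have jSi : j \in S :\ i by rewrite !inE eq_sym ij jS.
pose b x := if x == i then (a i).-1 else if x == j then (a j).+1 else a x.
have bi : b i = (a i).-1 by rewrite /b eqxx.
have bj : b j = (a j).+1 by rewrite /b eq_sym (negPf ij) eqxx.
have bE : {in S :\ i :\ j, b =1 a}.
  by move=> x; rewrite !inE /b => /and3P[/negPf -> /negPf -> _].
have := qb _ _ jS iS => qji.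
apply: (@leq_trans (elsym S b k.+2)).
  rewrite (elsymD2 a k iS jS ij) (elsymD2 b k iS jS ij) !(eq_elsym _ bE) bi bj.
  have -> : (a i).-1 + (a j).+1 = a i + a j by lia.
  by rewrite leq_add2l leq_mul2r; apply/orP; right; nia.
apply: IH.
  rewrite -aq !(big_setD1 i iS) !(big_setD1 j jSi) /= bi bj (eq_bigr a) //.
  by lia.
rewrite (big_setD1 i iS) (big_setD1 j jSi) /= bi bj.
rewrite (eq_bigr (fun x => a x - q x)) => [|x /bE -> //].
by move: an; rewrite (big_setD1 i iS) (big_setD1 j jSi) /=; lia.
Qed.

(** By [elsymD2], exchanging [a i], [a j] for [x], [y] gains exactly the product difference times
    the rest, and the new values still obey [leq_elsym_balanced]. *)
Lemma elsym_equalize S a q i j k x y : i \in S -> j \in S -> i != j ->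
  \sum_(i in S) a i = \sum_(i in S) q i ->
  {in S &, forall i j, q i <= (q j).+1} ->
  x + y = a i + a j -> a i * a j <= x * y ->
  elsym S a k.+2 + (x * y - a i * a j) * elsym (S :\ i :\ j) a k
    <= elsym S q k.+2.
Proof.
move=> iS jS ij aq qb xy le; have jSi : j \in S :\ i by rewrite !inE eq_sym ij jS.
pose b z := if z == i then x else if z == j then y else a z.
have bi : b i = x by rewrite /b eqxx.
have bj : b j = y by rewrite /b eq_sym (negPf ij) eqxx.
have bE : {in S :\ i :\ j, b =1 a}.
  by move=> z; rewrite !inE /b => /and3P[/negPf -> /negPf -> _].
have bq : \sum_(i in S) b i = \sum_(i in S) q i.
  rewrite -aq !(big_setD1 i iS) !(big_setD1 j jSi) /= bi bj (eq_bigr a) //.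
  by lia.
apply: leq_trans (leq_elsym_balanced k bq qb).
rewrite (elsymD2 a k iS jS ij) (elsymD2 b k iS jS ij) !(eq_elsym _ bE) bi bj xy.
by rewrite -addnA leq_add2l -mulnDl subnKC.
Qed.

End ElementarySymmetric.

(** * Cliques and rainbow sets *)

Definition clique (V : finType) (G : rel V) (K : {set V}) : bool :=
  [forall u in K, forall v in K, (u != v) ==> G u v].

Definition nbr (V : finType) (G : rel V) (u : V) : {set V} := [set v | G u v].

Definition clique_sum (V : finType) (G : rel V) (w : nat -> nat)
    (A : {set V}) : nat :=
  \sum_(K : {set V} | clique G K && (K \subset A)) w #|K|.

(* [clique (cdiff c)] says that a set is rainbow for the colouring [c]. *)
Definition cdiff (V : finType) (I : eqType) (c : V -> I) : rel V :=
  fun u v => c u != c v.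

Section Cliques.
Variables (V : finType) (G : rel V).
Hypotheses (Gsym : symmetric G) (Girr : irreflexive G).
Implicit Types (K A : {set V}) (w : nat -> nat).

Lemma cliqueP K : reflect {in K &, forall u v, u != v -> G u v} (clique G K).
Proof.
apply: (iffP forall_inP) => [h u v uK vK uv|h u uK].
  by have /forall_inP/(_ v vK)/implyP := h u uK; apply.
by apply/forall_inP => v vK; apply/implyP; apply: h.
Qed.

Lemma clique0 : clique G set0.
Proof. by apply/cliqueP => u v; rewrite inE. Qed.

Lemma sub_clique K A : K \subset A -> clique G A -> clique G K.
Proof.
move=> KA /cliqueP h; apply/cliqueP => u v /(subsetP KA) uA /(subsetP KA).
exact: h.
Qed.

Lemma notin_sub_nbr x K : K \subset nbr G x -> x \notin K.
Proof.
by move=> Kx; apply/negP => /(subsetP Kx); rewrite inE Girr.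
Qed.

Lemma cliqueU1 x K : x \notin K ->
  clique G (x |: K) = clique G K && (K \subset nbr G x).
Proof.
move=> xK; apply/idP/andP => [h|[/cliqueP hK /subsetP Kx]].
  split; first exact: sub_clique (subsetUr _ _) h.
  apply/subsetP => y yK; rewrite inE; apply: (cliqueP _ h); rewrite ?setU11 //.
    by rewrite !inE yK orbT.
  by apply: contraNneq xK => ->.
apply/cliqueP => u v; rewrite !inE => /predU1P[->|uK] /predU1P[->|vK].
- by rewrite eqxx.
- by move=> _; have := Kx _ vK; rewrite inE.
- by move=> _; have := Kx _ uK; rewrite inE Gsym.
- exact: hK.
Qed.

Lemma cliqueU1_nbr x K : clique G K -> K \subset nbr G x ->
  clique G (x |: K) /\ #|x |: K| = #|K|.+1.
Proof.
move=> hK Kx; have xK := notin_sub_nbr Kx.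
by rewrite cliqueU1 // hK Kx cardsU1 xK.
Qed.

Lemma sum_clique_mem (f : {set V} -> nat) A v : v \in A ->
  \sum_(K | (clique G K && (K \subset A)) && (v \in K)) f K =
  \sum_(K | clique G K && (K \subset A :&: nbr G v)) f (v |: K).
Proof.
move=> vA; rewrite (reindex_onto (fun K => v |: K) (fun K => K :\ v)) /=.
  apply: eq_bigl => K; rewrite setU11 andbT subUset sub1set vA /= subsetI.
  have [vK|vK] := boolP (v \in K).
    have /negPf -> : ~~ (K \subset nbr G v).
      by apply: contraL vK; apply: notin_sub_nbr.
    rewrite !andbF; apply/negP => /andP[_ /eqP/setP/(_ v)].
    by rewrite !inE eqxx vK.
  by rewrite cliqueU1 // setU1K // eqxx andbT -!andbA; do 2!bool_congr;
    rewrite andbC.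
by move=> K /andP[_ vK]; rewrite setD1K.
Qed.

Lemma sum_clique_meet (f : {set V} -> nat) (A W : {set V}) : W \subset A ->
  \sum_(K | clique G K && (K \subset A)) #|K :&: W| * f K =
  \sum_(v in W) \sum_(K | clique G K && (K \subset A :&: nbr G v)) f (v |: K).
Proof.
move=> WA; transitivity (\sum_(v in W)
    \sum_(K | (clique G K && (K \subset A)) && (v \in K)) f K).
  rewrite (exchange_big_dep (fun K => clique G K && (K \subset A))) /=;
    last by move=> v K _ /andP[].
  apply: eq_bigr => K KA; rewrite sum_nat_const; congr (_ * _).
  by apply: eq_card => v; rewrite !inE KA andbC.
by apply: eq_bigr => v vW; rewrite sum_clique_mem // (subsetP WA).
Qed.

End Cliques.

Section Rainbow.
Variables (V : finType) (I : eqType) (c : V -> I).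
Implicit Types (K A : {set V}) (w : nat -> nat).

Lemma cdiff_sym : symmetric (cdiff c).
Proof. by move=> u v; rewrite /cdiff eq_sym. Qed.

Lemma cdiff_irr : irreflexive (cdiff c).
Proof. by move=> u; rewrite /cdiff eqxx. Qed.

(** A rainbow set has at most one vertex of colour [i], and all vertices of that colour are
    completed by the same sets, the rainbow sets avoiding [i]. *)
Lemma rainbow_sum_split w A (i : I) :
  clique_sum (cdiff c) w A =
    clique_sum (cdiff c) w [set x in A | c x != i]
    + #|[set x in A | c x == i]|
      * clique_sum (cdiff c) (fun k => w k.+1) [set x in A | c x != i].
Proof.
set A' := [set x in A | c x != i]; set W := [set x in A | c x == i].
have WA : W \subset A by apply/subsetP => x; rewrite inE => /andP[].
rewrite {1}/clique_sum (bigID (fun K => K :&: W == set0)) /=; congr (_ + _).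
  apply: eq_bigl => K; rewrite -andbA; congr (_ && _).
  apply/andP/subsetP => [[/subsetP KA /eqP/setP KW] x xK|KA].
    by have := KW x; rewrite !inE xK KA //= => ->.
  split; first by apply/subsetP => x /KA; rewrite inE => /andP[].
  apply/eqP/setP => x; rewrite !inE; apply/negP => /and3P[/KA].
  by rewrite inE => /andP[_ /negP].
transitivity (\sum_(K | clique (cdiff c) K && (K \subset A))
    #|K :&: W| * w #|K|).
  rewrite [RHS](bigID (fun K => K :&: W == set0)) /= [X in _ = X + _]big1 => [|K].
    rewrite add0n; apply: eq_bigr => K /andP[/andP[/cliqueP hK _] KW].
    suff -> : #|K :&: W| = 1 by rewrite mul1n.
    apply/eqP; rewrite eqn_leq card_gt0 KW andbT; apply/card_le1_eqP => x y.
    rewrite !inE => /and3P[xK _ /eqP xi] /and3P[yK _ /eqP yi].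
    apply/eqP/negP => /negP xy; have := hK y x yK xK xy.
    by rewrite /cdiff xi yi eqxx.
  by move=> /andP[_ /eqP ->]; rewrite cards0.
rewrite (sum_clique_meet cdiff_sym cdiff_irr) // -sum_nat_const.
apply: eq_bigr => v; rewrite inE => /andP[vA /eqP vi].
have -> : A :&: nbr (cdiff c) v = A'.
  by apply/setP => x; rewrite !inE /cdiff vi eq_sym.
apply: eq_bigr => K /andP[_ KA']; congr w; rewrite cardsU1.
suff -> : v \notin K by [].
by apply/negP => /(subsetP KA'); rewrite inE vi eqxx andbF.
Qed.

End Rainbow.

(** A rainbow set is a choice of [k] colours and of one vertex in each of their classes. *)
Lemma rainbow_card (V I : finType) (c : V -> I) (A : {set V}) k :
  #|[set K : {set V} | [&& clique (cdiff c) K, K \subset A & #|K| == k]]| =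
  elsym [set: I] (fun i => #|[set x in A | c x == i]|) k.
Proof.
suff main (S : {set I}) : {in A, forall x, c x \in S} ->
  clique_sum (cdiff c) (fun j => j == k) A =
  elsym S (fun i => #|[set x in A | c x == i]|) k.
  rewrite -main => [|x _]; last by rewrite inE.
  rewrite /clique_sum -sum1_card big_mkcond [RHS]big_mkcond /=.
  apply: eq_bigr => K _; rewrite inE.
  by case: (clique _ _); case: (_ \subset _); case: (_ == _).
elim/setD1_ind: S A k => [|S i iS IH] A k AS.
  have -> : A = set0.
    by apply/setP => x; rewrite inE; apply/negP => /AS; rewrite inE.
  rewrite elsym_set0 /clique_sum (big_pred1 set0) ?cards0 1?eq_sym // => K.
  by rewrite subset0 /= andbC; case: eqP => //= ->; rewrite clique0.
rewrite (rainbow_sum_split _ _ _ i).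
set A' := [set x in A | c x != i].
have A'S : {in A', forall x, c x \in S :\ i}.
  by move=> x; rewrite !inE => /andP[/AS -> ->].
have aE : {in S :\ i, (fun j => #|[set x in A' | c x == j]|) =1
                      (fun j => #|[set x in A | c x == j]|)}.
  move=> j; rewrite !inE => /andP[ji _]; apply: eq_card => x; rewrite !inE.
  by case: (c x =P j) => [->|]; rewrite ?andbF // ji andbT.
rewrite IH // (eq_elsym _ aE).
case: k => [|k]; last first.
  by rewrite (elsymD1 _ _ iS); congr (_ + _ * _); rewrite IH // (eq_elsym _ aE).
by rewrite !elsym0 /clique_sum big1 ?muln0.
Qed.

(** * Symmetrization with an error term *)

Section Turan.
Variables (V : finType) (G : rel V).
Hypotheses (Gsym : symmetric G) (Girr : irreflexive G).
Implicit Types (K A : {set V}) (w : nat -> nat).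

Lemma clique_sum_lin (E : rel V) w w' a A :
  clique_sum E (fun k => w k + a * w' k) A =
  clique_sum E w A + a * clique_sum E w' A.
Proof. by rewrite /clique_sum big_split /= big_distrr. Qed.

Lemma sum_cliques_sub (f : {set V} -> nat) A A' : A' \subset A ->
  \sum_(K | clique G K && (K \subset A)) (K \subset A') * f K =
  \sum_(K | clique G K && (K \subset A')) f K.
Proof.
move=> sA; rewrite big_mkcond [RHS]big_mkcond /=; apply: eq_bigr => K _.
have [KA'|_] := boolP (K \subset A'); last by rewrite andbF mul0n if_same.
by rewrite (subset_trans KA' sA) mul1n.
Qed.

Definition non_rainbow (c : V -> nat) K : nat := ~~ clique (cdiff c) K.

(* Füredi's stability version of Zykov's symmetrization, for cliques weighted
   by their size: the first colour class is the set of non-neighbours of a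
   vertex of maximal weighted degree. Passing to its neighbourhood replaces the
   weight [w k] by [w k + #|class| * w k.+1], which is why the induction needs
   arbitrary weights. *)
Lemma clique_sum_le_rainbow m A w :
  (forall K, clique G K -> K \subset A -> #|K| <= m) ->
  exists c : V -> nat, (forall x, x \in A -> c x < m) /\
    \sum_(K | clique G K && (K \subset A)) w #|K| * (1 + non_rainbow c K)
      <= clique_sum (cdiff c) w A.
Proof.
have base w0 (c : V -> nat) :
  \sum_(K | clique G K && (K \subset set0)) w0 #|K| * (1 + non_rainbow c K)
    <= clique_sum (cdiff c) w0 set0.
  rewrite /clique_sum !(big_pred1 set0) => [||K].
  - by rewrite /non_rainbow clique0 addn0 muln1.
  - by move=> K; rewrite subset0 /= andbC; case: eqP => //= ->; rewrite clique0.
  - by rewrite subset0 /= andbC; case: eqP => //= ->; rewrite clique0.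
elim: m A w => [|m IH] A w Am.
  have -> : A = set0.
    apply/setP => x; rewrite inE; apply/negP => xA.
    have /Am : clique G [set x].
      by apply/cliqueP => u v /set1P -> /set1P ->; rewrite eqxx.
    by rewrite sub1set xA cards1 => /(_ isT).
  by exists (fun=> 0); split => // x; rewrite inE.
have [->|[x0 x0A]] := set_0Vmem A.
  by exists (fun=> 0); split => // x; rewrite inE.
pose ws k := w k.+1.
(* The weight of the cliques of [A] through [v]: each has one vertex more than its trace in the
   neighbourhood, hence [ws]. *)
pose g v := clique_sum G ws (A :&: nbr G v).
have [x xA' gx] := arg_maxnP g x0A; have xA : x \in A := xA'.
pose A' := A :&: nbr G x; pose W := A :\: A'.
have A'A : A' \subset A by apply: subsetIl.
have WA : W \subset A by apply: subsetDl.
have AW y : y \in A -> (y \in W) = (y \notin A').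
  by move=> yA; rewrite in_setD yA andbT.
have A'm K : clique G K -> K \subset A' -> #|K| <= m.
  rewrite subsetI => hK /andP[KA Kx].
  have [hxK cxK] := cliqueU1_nbr Gsym Girr hK Kx.
  by rewrite -ltnS -cxK; apply: Am => //; rewrite subUset sub1set xA.
have [c' [c'm c'le]] := IH A' (fun k => w k + #|W| * ws k) A'm.
pose c y := if y \in A' then c' y else m.
have cm y : (y \in A) && (c y != m) = (y \in A').
  rewrite /c; case: ifP => [yA'|]; last by rewrite eqxx andbF.
  by rewrite (subsetP A'A) //= neq_ltn c'm.
have cW y : (y \in A) && (c y == m) = (y \in W).
  by rewrite in_setD -cm; case: (y \in A); case: (c y == m).
have cc' K : K \subset A' -> clique (cdiff c) K = clique (cdiff c') K.
  move=> /subsetP KA'; apply/cliqueP/cliqueP => h u v uK vK uv;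
    by move: (h u v uK vK uv); rewrite /cdiff /c !KA'.
exists c; split.
  move=> y yA; rewrite /c; case: ifP => // yA'.
  by apply: leq_trans (c'm _ yA') _.
rewrite (rainbow_sum_split _ _ _ m).
have -> : [set y in A | c y != m] = A' by apply/setP => y; rewrite inE cm.
have -> : [set y in A | c y == m] = W by apply/setP => y; rewrite inE cW.
have TE w0 : clique_sum (cdiff c) w0 A' = clique_sum (cdiff c') w0 A'.
  rewrite /clique_sum; apply: eq_bigl => K.
  by have [KA'|] := boolP (K \subset A'); rewrite ?andbF // cc'.
rewrite !TE -clique_sum_lin; apply: leq_trans c'le.
pose nr K := non_rainbow c K.
(* A clique meeting [W] at least twice is paid for by the multiplicity [#|K :&: W|], since
   [1 + nr K <= 2]. One meeting it once is non-rainbow only if its part outside [W] is, and [h]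
   charges just these. *)
pose h K := (#|K :&: W| == 1) * (w #|K| * nr (K :\: W)).
have pointwise K : K \subset A ->
  w #|K| * (1 + nr K) <=
    (K \subset A') * (w #|K| * (1 + nr K)) + #|K :&: W| * w #|K|
    + #|K :&: W| * h K.
  move=> KA; have [_|KA'] := boolP (K \subset A'); first by lia.
  have KW0 : 0 < #|K :&: W|.
    rewrite card_gt0; apply: contra KA' => /eqP/setP KW; apply/subsetP => y yK.
    by have := KW y; rewrite in_setI yK AW ?(subsetP KA) // in_set0 => /negbFE.
  rewrite mul0n add0n; have [|KW1] := leqP 2 #|K :&: W|.
    have : nr K <= 1 by rewrite /nr /non_rainbow; case: clique.
    by nia.
  have KW : #|K :&: W| = 1 by lia.
  rewrite /h KW eqxx !mul1n mulnDr muln1 leq_add2l leq_mul2l; apply/orP; right.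
  rewrite /nr /non_rainbow; have [//|nK] := boolP (clique (cdiff c) K).
  have [/cliqueP rK|//] := boolP (clique (cdiff c) (K :\: W)).
  case/negP: nK; apply/cliqueP => y z yK zK yz.
  have outW t : t \in K -> t \notin W -> c t != m.
    move=> tK; have tA := subsetP KA t tK.
    by rewrite AW // negbK -cm => /andP[].
  have inW t : t \in K -> t \in W -> c t = m.
    by move=> tK; rewrite -cW => /andP[_ /eqP].
  have [yW|yW] := boolP (y \in W); have [zW|zW] := boolP (z \in W).
  - have /card_le1_eqP/(_ y z) : #|K :&: W| <= 1 by rewrite KW.
    rewrite !in_setI yK zK yW zW => /(_ isT isT) /eqP.
    by rewrite ?[z == y]eq_sym (negPf yz).
  - by rewrite /cdiff (inW y) // eq_sym outW.
  - by rewrite /cdiff (inW z) // outW.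
  - by apply: rK; rewrite // inE ?yW ?zW ?yK ?zK.
apply: (@leq_trans (\sum_(K | clique G K && (K \subset A))
    ((K \subset A') * (w #|K| * (1 + nr K)) + #|K :&: W| * w #|K|
     + #|K :&: W| * h K))).
  by apply: leq_sum => K /andP[_ KA]; apply: pointwise.
rewrite !big_split /= sum_cliques_sub //.
rewrite (sum_clique_meet Gsym Girr (fun K => w #|K|) WA).
rewrite (sum_clique_meet Gsym Girr h WA).
have -> : \sum_(K | clique G K && (K \subset A'))
    (w #|K| + #|W| * ws #|K|) * (1 + non_rainbow c' K) =
  \sum_(K | clique G K && (K \subset A')) w #|K| * (1 + nr K)
  + #|W| * clique_sum G ws A'
  + #|W| * \sum_(K | clique G K && (K \subset A')) ws #|K| * nr K.
  rewrite /clique_sum !big_distrr -!big_split /=; apply: eq_bigr => K /andP[_ KA'].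
  rewrite /nr /non_rainbow cc' //; lia.
(* The first summands agree, the second compare by maximality of [x], and the third because
   [h (v |: K)] vanishes when [K] meets [W], as [v] is already there. *)
rewrite leq_add // ?leq_add //.
- rewrite -sum_nat_const; apply: leq_sum => v vW.
  apply: leq_trans (gx v (subsetP WA _ vW)).
  apply: eq_leq; apply: eq_bigr => K /andP[_]; rewrite subsetI => /andP[_ Kv].
  by rewrite cardsU1 (notin_sub_nbr Girr Kv).
- rewrite -sum_nat_const; apply: leq_sum => v vW.
  rewrite big_mkcond [leqRHS]big_mkcond /=; apply: leq_sum => K _.
  case: ifP => // /andP[hK]; rewrite subsetI => /andP[KA Kv]; rewrite hK /=.
  have vK := notin_sub_nbr Girr Kv; rewrite /h.
  have [KA'|KA'] := boolP (K \subset A'); last first.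
    suff /negPf -> : #|(v |: K) :&: W| != 1 by rewrite mul0n.
    rewrite neq_ltn; apply/orP; right.
    have [y yK yA'] := subsetPn KA'.
    have <- : #|[set v; y]| = 2.
      by rewrite cards2; case: eqP => // vy; rewrite vy yK in vK.
    apply: subset_leq_card; apply/subsetP => z /set2P[] ->.
      by rewrite inE setU11 vW.
    by rewrite in_setI in_setU1 yK orbT AW // (subsetP KA).
  have -> : (v |: K) :\: W = K.
    apply/setP => y; rewrite in_setD in_setU1.
    have [->|yv] /= := eqVneq y v; first by rewrite vW (negPf vK).
    have [yK|] /= := boolP (y \in K); last by rewrite andbF.
    by rewrite AW ?(subsetP KA) // (subsetP KA').
  rewrite cardsU1 vK /ws; case: eqP => _ //=; by rewrite mul1n.
Qed.

End Turan.

(** * Stability of the Turán bound *)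

Lemma elsym_drop (I : finType) (S : {set I}) (a : I -> nat) i k :
  i \in S -> a i = 0 -> elsym S a k = elsym (S :\ i) a k.
Proof.
by move=> iS ai; case: k => [|k]; rewrite ?elsym0 // (elsymD1 _ _ iS) ai addn0.
Qed.

Lemma sum_color_classes (V I : finType) (c : V -> I) (A : {set V}) :
  \sum_i #|[set x in A | c x == i]| = #|A|.
Proof.
rewrite -[RHS]sum1_card (partition_big c predT) //=; apply: eq_bigr => i _.
by rewrite -sum1_card; apply: eq_bigl => x; rewrite inE.
Qed.

Lemma complete_partite_rainbow (V : finType) (r l : nat) (c : V -> 'I_l)
    (U : {set V}) (P : 'I_l -> {set V}) :
  (forall i, P i = [set x in U | c x == i]) ->
  complete_partite r P =
    [set K : {set V} | [&& clique (cdiff c) K, K \subset U & #|K| == r]].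
Proof.
move=> PE.
have UE : \bigcup_i P i = U.
  apply/setP => x; apply/bigcupP/idP => [[i _]|xU].
    by rewrite PE inE => /andP[].
  by exists (c x); rewrite // PE inE xU eqxx.
apply/setP => K; rewrite !inE UE andbCA [RHS]andbCA.
have [KU|//] /= := boolP (K \subset U); rewrite andbC; congr (_ && _).
apply/forallP/cliqueP => [h u v uK vK uv|h i].
  apply/negP => /eqP cuv; have /card_le1_eqP/(_ u v) := h (c u).
  rewrite PE !inE uK vK !(subsetP KU) // cuv eqxx => /(_ isT isT)/eqP.
  by rewrite ?[v == u]eq_sym (negPf uv).
apply/card_le1_eqP => u v; rewrite PE !inE.
move=> /and3P[uK _ /eqP cu] /and3P[vK _ /eqP cv]; apply/eqP/negP => /negP uv.
by have := h _ _ vK uK uv; rewrite /cdiff cu cv eqxx.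
Qed.

Lemma turan_number_elsym r n l : 0 < l ->
  turan_number r n l = elsym [set: 'I_l] (fun i => #|@turan_part n l i|) r.
Proof.
move=> l0; pose c (x : 'I_n) : 'I_l := Ordinal (ltn_pmod x l0).
have PE (i : 'I_l) : turan_part n i = [set x in [set: 'I_n] | c x == i].
  by apply/setP => x; rewrite !inE.
rewrite /turan_number /turan_graph (complete_partite_rainbow r PE) rainbow_card.
by apply: eq_elsym => i _; rewrite PE.
Qed.

Lemma sum_turan_part n l : 0 < l -> \sum_(i < l) #|@turan_part n l i| = n.
Proof.
move=> l0; pose c (x : 'I_n) : 'I_l := Ordinal (ltn_pmod x l0).
rewrite -[RHS]card_ord -cardsT -(sum_color_classes c); apply: eq_bigr => i _.
by apply: eq_card => x; rewrite !inE.
Qed.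

(** Otherwise balancedness bounds all parts by [n %/ l] and this one by less, so their total falls
    below [n]. *)
Lemma leq_turan_part n l (i : 'I_l) : n %/ l <= #|turan_part n i|.
Proof.
have l0 : 0 < l by apply: leq_ltn_trans (ltn_ord i).
rewrite leqNgt; apply/negP => lt.
have : \sum_(j < l) #|@turan_part n l j| < \sum_(j < l) n %/ l.
  rewrite (bigD1 i) //= [ltnRHS](bigD1 i) //= -addSn leq_add //.
  by apply: leq_sum => j _; apply: leq_trans (turan_part_balanced n j i) lt.
rewrite sum_turan_part // sum_nat_const card_ord.
by have := leq_divM n l; lia.
Qed.

Lemma leq_exp_sub n l r : n ^ r <= (n - l) ^ r + r * l * n ^ r.-1.
Proof.
case: r => [|r] /=; first by rewrite !expn0.
elim: r => [|r IH]; first by rewrite !expn1 expn0; lia.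
have : (n - l) ^ r.+1 <= n ^ r.+1 by rewrite leq_exp2r // leq_subr.
have : n * n ^ r.+1 <= n * ((n - l) ^ r.+1 + r.+1 * l * n ^ r).
  by rewrite leq_mul2l IH orbT.
rewrite (expnS n r.+1) (expnS (n - l) r.+1).
have -> : n * ((n - l) ^ r.+1 + r.+1 * l * n ^ r) =
  n * (n - l) ^ r.+1 + r.+1 * l * n ^ r.+1 by rewrite (expnS n r); lia.
by case: (leqP l n) => ln; nia.
Qed.

(** Shrinking every part to [n %/ l], which is at least [(n - l) / l], costs at most a factor 2, by
    [leq_exp_sub] and the size of [n]. *)
Lemma leq_turan_number r n l : 0 < r -> 0 < l -> 2 * r * l <= n ->
  'C(l, r) * n ^ r <= 2 * (turan_number r n l * l ^ r).
Proof.
move=> r0 l0 nbig; rewrite turan_number_elsym //.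
have : 'C(l, r) * (n %/ l) ^ r <=
    elsym [set: 'I_l] (fun i => #|@turan_part n l i|) r.
  have := elsym_const [set: 'I_l] (n %/ l) r; rewrite cardsT card_ord => <-.
  by apply: leq_elsym => i _; apply: leq_turan_part.
set t := elsym _ _ _ => ht.
have q1 : n - l <= n %/ l * l.
  by rewrite leq_subLR {1}(divn_eq n l) addnC leq_add2r ltnW // ltn_pmod.
have q2 : (n - l) ^ r <= (n %/ l) ^ r * l ^ r by rewrite -expnMn leq_exp2r.
have q3 : n ^ r <= 2 * (n - l) ^ r.
  have := leq_exp_sub n l r.
  have : 2 * r * l * n ^ r.-1 <= n ^ r.
    by rewrite -[X in _ <= _ ^ X](prednK r0) expnS leq_mul2r nbig orbT.
  by lia.
have : 'C(l, r) * n ^ r <= 'C(l, r) * (2 * ((n %/ l) ^ r * l ^ r)).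
  by rewrite leq_mul2l (leq_trans q3) ?orbT // leq_mul2l q2 orbT.
move/leq_trans; apply.
rewrite mulnCA leq_mul2l /= mulnA leq_mul2r ht orbT //.
Qed.

Definition cliques (V : finType) (G : rel V) (r : nat) : {set {set V}} :=
  [set K : {set V} | clique G K & #|K| == r].

Definition color_size (V : finType) (I : eqType) (c : V -> I) (i : I) : nat :=
  #|[set x in [set: V] | c x == i]|.

(** Ordered pairs, so that the missing degrees add up to its cardinality. *)
Definition missing (V : finType) (I : eqType) (G : rel V) (c : V -> I) :
    {set V * V} :=
  [set p : V * V | cdiff c p.1 p.2 && ~~ G p.1 p.2].

(** * Class sizes and missing pairs near the Turán bound *)

Section Stability.
Variables (V : finType) (G : rel V) (l k : nat).
Hypotheses (Gsym : symmetric G) (Girr : irreflexive G) (l0 : 0 < l).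
Let n := #|V|.
Let r := k.+2.
Let t := turan_number r n l.
Let N := #|cliques G r|.

Lemma leq_cliques_elsym m : m <= l ->
  (forall K, clique G K -> #|K| <= m) ->
  exists c : V -> 'I_l, (forall x, c x < m) /\
    N + #|[set K in cliques G r | ~~ clique (cdiff c) K]|
      <= elsym [set: 'I_l] (color_size c) r.
Proof.
move=> ml Gm.
have [c [cm cle]] := clique_sum_le_rainbow Gsym Girr (A := [set: V])
  (fun j => j == r) (fun K hK _ => Gm K hK).
pose c' x : 'I_l := Ordinal (leq_trans (cm x (in_setT x)) ml).
exists c'; split; first by move=> x; apply: (cm x (in_setT x)).
have <- : #|[set K : {set V} | [&& clique (cdiff c') K,
    K \subset [set: V] & #|K| == r]]| = elsym [set: 'I_l] (color_size c') r.
  exact: rainbow_card.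
have cc' : cdiff c' =2 cdiff c by [].
apply: leq_trans (leq_trans cle _); last first.
  rewrite /clique_sum -sum1_card big_mkcond [leqRHS]big_mkcond /=.
  apply: leq_sum => K _; rewrite inE.
  have -> : clique (cdiff c) K = clique (cdiff c') K by [].
  by case: (clique _ _); case: (_ \subset _); case: (_ == _).
rewrite /N -!sum1_card big_mkcond [X in _ + X]big_mkcond -big_split /=.
rewrite [leqRHS]big_mkcond; apply: leq_sum => K _.
rewrite !inE subsetT andbT /non_rainbow.
have -> : clique (cdiff c) K = clique (cdiff c') K by [].
by case: (clique G K); case: (_ == r); case: (clique _ _).
Qed.

Lemma leq_elsym_turan (c : V -> 'I_l) :
  elsym [set: 'I_l] (color_size c) r <= t.
Proof.
rewrite /t turan_number_elsym //; apply: leq_elsym_balanced => [|i j _ _].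
  transitivity n; last by rewrite -[LHS](sum_turan_part _ l0) big_set /=.
  by rewrite big_set /= sum_color_classes cardsT.
exact: turan_part_balanced.
Qed.

Lemma leq_cliques_turan : (forall K, clique G K -> #|K| <= l) -> N <= t.
Proof.
move=> /(leq_cliques_elsym (leqnn l))[c [_ le]].
by apply: leq_trans (leq_elsym_turan c); apply: leq_trans le; apply: leq_addr.
Qed.

Lemma sum_color_size (c : V -> 'I_l) :
  \sum_(i in [set: 'I_l]) color_size c i = n.
Proof. by rewrite big_set /= sum_color_classes cardsT. Qed.

(** A class [i] of size at most [n / 2l] coexists with a class [j] of size at least [n / l]. By
    [leq_elsym_pair], equalizing the two would gain at least a [1 / (32 l^2)] share of [elsym], but
    the gain is at most [t - N]. *)
Lemma color_size_gt (c : V -> 'I_l) i :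
  33 * l ^ 2 * (t - N) < t -> 4 * l <= n ->
  N <= elsym [set: 'I_l] (color_size c) r -> n < 2 * l * color_size c i.
Proof.
move=> tN nl NE; rewrite ltnNge; apply/negP => ai.
have [j aj] : exists j, n <= l * color_size c j.
  apply/existsP; rewrite -[X in is_true X]negbK negb_exists; apply/negP.
  move=> /forallP lt; have : \sum_(j < l) l * color_size c j < \sum_(j < l) n.
    rewrite (bigD1 i) //= [ltnRHS](bigD1 i) //= -addSn leq_add //.
      by rewrite ltnNge lt.
    by apply: leq_sum => j _; apply: ltnW; rewrite ltnNge lt.
  rewrite -big_distrr /= sum_nat_const card_ord.
  by have := sum_color_size c; rewrite big_set /= => ->; rewrite ltnn.
set a := color_size c in ai aj NE *.
have ij : i != j by apply/eqP => ij; move: aj ai; rewrite ij; nia.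
(* The halves of the common sum, off by one if it is odd: this is the [+ 1] in [gain4], absorbed
   later by [4 * l <= n]. *)
pose x := (a i + a j)./2; pose y := a i + a j - x.
have xy : x + y = a i + a j by rewrite /y /x; lia.
have diff : n <= 2 * l * (a j - a i) by nia.
have gain4 : (a j - a i) ^ 2 <= 4 * (x * y - a i * a j) + 1.
  have : y = x \/ y = x.+1 by rewrite /y /x; lia.
  by case=> yx; rewrite yx; move: xy; rewrite yx; nia.
have le : a i * a j <= x * y.
  have : y = x \/ y = x.+1 by rewrite /y /x; lia.
  by case=> yx; rewrite yx; move: xy; rewrite yx; nia.
have sum_eq : \sum_(i in [set: 'I_l]) a i =
    \sum_(i in [set: 'I_l]) #|@turan_part n l i|.
  by rewrite sum_color_size big_set /= sum_turan_part.
have := elsym_equalize k (in_setT i) (in_setT j) ij sum_eq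
  (fun i j _ _ => turan_part_balanced n i j) xy le.
rewrite -turan_number_elsym // -/r -/t.
have := leq_elsym_pair a k (in_setT i) (in_setT j) ij.
rewrite sum_color_size -/r.
move: NE; set E := elsym _ a r; set Q := elsym _ a k => NE EQ Et.
set g := x * y - a i * a j in gain4 Et.
have gn : n ^ 2 <= 32 * l ^ 2 * g.
  have : n ^ 2 <= 4 * l ^ 2 * (a j - a i) ^ 2 by nia.
  have : 16 * l ^ 2 <= n ^ 2 by nia.
  by nia.
have n0 : 0 < n by lia.
have : n ^ 2 * E <= n ^ 2 * (32 * l ^ 2 * (t - N)).
  apply: (@leq_trans (32 * l ^ 2 * g * (n ^ 2 * Q))).
    by rewrite leq_mul.
  have -> : 32 * l ^ 2 * g * (n ^ 2 * Q) = n ^ 2 * (32 * l ^ 2 * (g * Q)) by lia.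
  by rewrite !leq_mul2l; apply/orP; right; apply/orP; right; lia.
rewrite leq_pmul2l ?expn_gt0 ?n0 // => E32.
have : t - N <= l ^ 2 * (t - N) by rewrite leq_pmull // expn_gt0 l0.
by lia.
Qed.

(** Without an [l]-clique the symmetrization needs only [l - 1] colours, and the empty last class
    contradicts [color_size_gt]. *)
Lemma exists_clique_l :
  (forall K, clique G K -> #|K| <= l) ->
  33 * l ^ 2 * (t - N) < t -> 4 * l <= n ->
  exists K, clique G K /\ #|K| = l.
Proof.
move=> Gl tN nl.
have [/existsP[K /andP[hK /eqP cK]]|nK] :=
  boolP [exists K, clique G K && (#|K| == l)]; first by exists K.
have Gl1 K : clique G K -> #|K| <= l.-1.
  move=> hK; have := Gl K hK; rewrite leq_eqVlt => /orP[Kl|]; last by lia.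
  by move: nK; rewrite negb_exists => /forallP/(_ K); rewrite hK Kl.
have [c [cl NE]] := leq_cliques_elsym (leq_pred l) Gl1.
have l1l : l.-1 < l by rewrite prednK.
have := color_size_gt (Ordinal l1l) tN nl (leq_trans (leq_addr _ _) NE).
suff -> : color_size c (Ordinal l1l) = 0 by rewrite muln0.
apply/eqP; rewrite cards_eq0; apply/eqP/setP => x; rewrite !inE /=.
by apply/negP => /eqP cx; have := cl x; rewrite cx ltnn.
Qed.

(* A missing pair of colours [i], [j] lies in [elsym] of the other colours many
   rainbow [r]-sets, none of which is a clique. *)
Lemma leq_card_missing (c : V -> 'I_l) :
  33 * l ^ 2 * (t - N) < t ->
  N + #|[set K in cliques G r | ~~ clique (cdiff c) K]|
    <= elsym [set: 'I_l] (color_size c) r ->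
  #|missing G c| * t <= 4 * r ^ 2 * n ^ 2 * (t - N).
Proof.
move=> tN NE; set E := elsym _ _ _ in NE.
pose X := [set K : {set V} | [&& clique (cdiff c) K, #|K| == r & ~~ clique G K]].
(* [E] counts all rainbow [r]-sets. Both [E - N] and the number of non-rainbow cliques are at most
   [t - N], whence the factor 2. *)
have cardX : #|X| <= 2 * (t - N).
  have EC : E = #|[set K : {set V} | [&& clique (cdiff c) K,
      K \subset [set: V] & #|K| == r]]| by rewrite rainbow_card.
  have EX : E + #|[set K in cliques G r | ~~ clique (cdiff c) K]| = N + #|X|.
    rewrite EC /N -!sum1_card big_mkcond [X in _ + X]big_mkcond -big_split /=.
    rewrite [X in _ = X + _]big_mkcond [X in _ = _ + X]big_mkcond -big_split /=.
    apply: eq_bigr => K _.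
    rewrite !inE subsetT.
    by case: (clique G K); case: (_ == r); case: (clique _ _).
  by have := leq_elsym_turan c; rewrite -/E; lia.
pose Xp (p : V * V) := [set K in X | (p.1 \in K) && (p.2 \in K)].
have cardXp p : p \in missing G c -> E <= n ^ 2 * #|Xp p|.
  case: p => u v; rewrite inE /= => /andP[cuv Guv].
  have := leq_elsym_pair (color_size c) k (in_setT (c u)) (in_setT (c v)) cuv.
  rewrite sum_color_size -/r -/E => /leq_trans; apply; rewrite leq_mul2l.
  apply/orP; right.
  pose A := [set x | (c x != c u) && (c x != c v)].
  have aA : {in [set: 'I_l] :\ c u :\ c v, color_size c =1
      (fun i => #|[set x in A | c x == i]|)}.
    move=> i; rewrite !inE => /and3P[iv iu _]; apply: eq_card => x; rewrite !inE.
    by have [->|] := eqVneq (c x) i; rewrite ?andbF // iu iv.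
  have a0 i : (i == c u) || (i == c v) -> #|[set x in A | c x == i]| = 0.
    move=> iuv; apply/eqP; rewrite cards_eq0; apply/eqP/setP => x; rewrite !inE.
    by have [->|] := eqVneq (c x) i; rewrite ?andbF // andbT -negb_or iuv.
  have -> : elsym ([set: 'I_l] :\ c u :\ c v) (color_size c) k =
      elsym [set: 'I_l] (fun i => #|[set x in A | c x == i]|) k.
    rewrite (eq_elsym _ aA) [RHS](elsym_drop _ (in_setT (c u))) ?a0 ?eqxx //.
    have cv : c v \in [set: 'I_l] :\ c u by rewrite !inE eq_sym andbT.
    by rewrite [RHS](elsym_drop _ cv) ?a0 ?eqxx ?orbT.
  rewrite -rainbow_card; set S := [set _ | _].
  have notin K : K \in S -> (u \notin K) && (v \notin K).
    rewrite inE => /and3P[_ /subsetP KA _]; apply/andP; split; apply/negP => /KA.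
      by rewrite inE eqxx.
    by rewrite inE eqxx andbF.
  have uv : u != v by apply: contraNneq cuv => ->.
  (* Adding [u] and [v] to a rainbow [k]-set without their colours gives a member of [Xp],
     injectively. *)
  rewrite -(@card_in_imset _ _ (fun K => u |: (v |: K)) S).
    apply: subset_leq_card; apply/subsetP => _ /imsetP[K KS ->].
    have /andP[uK vK] := notin _ KS.
    move: KS; rewrite inE => /and3P[hK /subsetP KA /eqP cK].
    have uvK : u \notin v |: K by rewrite !inE negb_or uv.
    rewrite !inE !eqxx orbT /= andbT.
    rewrite !cardsU1 uvK vK cK eqxx /=.
    apply/andP; split.
      rewrite (cliqueU1 (cdiff_sym c)) // (cliqueU1 (cdiff_sym c)) // hK /=.
      apply/andP; split; apply/subsetP => x.
        by move=> /KA; rewrite !inE /cdiff [c v == _]eq_sym => /andP[].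
      rewrite !inE => /predU1P[->//|/KA].
      by rewrite !inE /cdiff [c u == _]eq_sym => /andP[].
    by apply: contra Guv => /cliqueP; apply; rewrite // !inE eqxx ?orbT.
  move=> K1 K2 /notin/andP[u1 v1] /notin/andP[u2 v2].
  move=> /(congr1 (fun K => K :\ u :\ v)).
  by rewrite !setU1K // !inE negb_or uv.
have sumX : \sum_(p in missing G c) #|Xp p| <= r ^ 2 * #|X|.
  have -> : \sum_(p in missing G c) #|Xp p| =
      \sum_(K in X) #|[set p in missing G c | (p.1 \in K) && (p.2 \in K)]|.
    under eq_bigr do rewrite -sum1_card.
    under [RHS]eq_bigr do rewrite -sum1_card.
    rewrite (exchange_big_dep (mem X)) /=; last first.
      by move=> p K _; rewrite inE => /andP[].
    apply: eq_bigr => K KX; apply: eq_bigl => p; rewrite !inE.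
    by move: KX; rewrite inE => ->.
  rewrite mulnC -sum_nat_const; apply: leq_sum => K.
  rewrite inE => /and3P[_ /eqP cK _].
  apply: (@leq_trans #|setX K K|); last by rewrite cardsX cK.
  by apply: subset_leq_card; apply/subsetP => p; rewrite !inE => /andP[_ ->].
have Mt : #|missing G c| * E <= n ^ 2 * (r ^ 2 * (2 * (t - N))).
  rewrite -sum_nat_const.
  apply: (@leq_trans (\sum_(p in missing G c) n ^ 2 * #|Xp p|)).
    exact: leq_sum.
  rewrite -big_distrr /= leq_mul2l; apply/orP; right.
  by apply: leq_trans sumX _; rewrite leq_mul2l cardX orbT.
have tE : t <= 2 * E.
  have : t - N <= l ^ 2 * (t - N) by rewrite leq_pmull // expn_gt0 l0.
  by lia.
apply: (@leq_trans (#|missing G c| * (2 * E))); first by rewrite leq_mul.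
by move: Mt; lia.
Qed.

End Stability.

(** * Missing pairs *)

(** The constant of [cover_bad_pairs]: a level branches on at most [(2 * m + 1) * d] vertices, and
    the 2 pays for deleting a set of size [2 * d] outright. *)
Fixpoint cover_const (m : nat) : nat :=
  if m is m'.+1 then (2 * m + 1) * cover_const m' else 2.

Lemma cover_const_ge2 m : 2 <= cover_const m.
Proof. by elim: m => //= m IH; rewrite (leq_trans IH) // leq_pmull // addn1. Qed.

Section Missing.
Variables (V : finType) (I : eqType) (G : rel V) (c : V -> I).
Hypotheses (Gsym : symmetric G) (Girr : irreflexive G).

Definition miss (v : V) : {set V} := [set u | cdiff c v u && ~~ G v u].

Lemma sum_card_miss : \sum_v #|miss v| = #|missing G c|.
Proof.
under eq_bigr do rewrite -sum1_card.
rewrite pair_big_dep /= -sum1_card; apply: eq_bigl => -[u v].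
by rewrite !inE.
Qed.

(** Markov's inequality for the missing degrees. *)
Lemma card_miss_gt h :
  #|[set v | h < #|miss v|]| * h.+1 <= #|missing G c|.
Proof.
rewrite -sum_card_miss -sum_nat_const.
rewrite [leqRHS](bigID (mem [set v | h < #|miss v|])) /=.
apply: leq_trans (leq_addr _ _); apply: leq_sum => v.
by rewrite inE.
Qed.

(** For each colour in turn, a vertex outside [B] adjacent to everything so far is chosen: each
    earlier vertex has another colour and so excludes at most [h] candidates. Chosen vertices join
    [S], while [#|S| + size J] does not grow. *)
Lemma greedy_clique (B S : {set V}) (J : seq I) (h : nat) :
  (forall v, v \notin B -> #|miss v| <= h) ->
  (forall v, v \in S -> v \notin B) ->
  uniq J -> (forall v, v \in S -> c v \notin J) ->
  (forall j, j \in J ->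
     #|B| + (#|S| + size J) * h < #|[set x in [set: V] | c x == j]|) ->
  exists P : {set V}, [/\ clique G P, #|P| = size J,
    forall p, p \in P -> p \notin B,
    forall p, p \in P -> c p \in J &
    forall p s, p \in P -> s \in S -> G s p].
Proof.
move=> Bh; elim: J S => [|j J IH] S SB /=.
  by move=> _ _ _; exists set0; rewrite clique0 cards0; split=> // p; rewrite inE.
move=> /andP[jJ uJ] SJ big.
pose Cj := [set x in [set: V] | c x == j].
have [x xC xout] : exists2 x, x \in Cj & x \notin B :|: \bigcup_(s in S) miss s.
  apply/subsetPn; apply/negP => /subset_leq_card; rewrite leqNgt; case/negP.
  apply: leq_ltn_trans (big j (mem_head _ _)).
  rewrite cardsU; apply: leq_trans (leq_subr _ _) _; rewrite leq_add2l.
  apply: (@leq_trans (\sum_(s in S) h)); last first.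
    by rewrite sum_nat_const leq_mul2r leq_addr orbT.
  elim/big_ind2: _ => [|A a A' a' hA hA'|s sS]; first by rewrite cards0.
    by rewrite cardsU; apply: leq_trans (leq_subr _ _) _; rewrite leq_add.
  by rewrite Bh // SB.
move: xC; rewrite !inE /= => /eqP cx.
move: xout; rewrite inE negb_or => /andP[xB xm].
have Sx s : s \in S -> G s x.
  move=> sS; apply/negPn/negP => nG; case/negP: xm; apply/bigcupP; exists s => //.
  rewrite inE nG andbT /cdiff cx; have := SJ s sS.
  by rewrite inE negb_or => /andP[].
have cS : #|x |: S| <= #|S|.+1 by rewrite cardsU1; case: (_ \notin _).
have [|||P [hP cP PB PJ PS]] := IH (x |: S) _ uJ.
- by move=> v; rewrite !inE => /predU1P[->|/SB].
- move=> v; rewrite !inE => /predU1P[->|/SJ]; first by rewrite cx.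
  by rewrite inE negb_or => /andP[].
- move=> j' j'J; apply: leq_ltn_trans (big j' _); last by rewrite inE j'J orbT.
  by rewrite leq_add2l leq_mul2r; apply/orP; right; lia.
have Px : P \subset nbr G x.
  by apply/subsetP => p pP; rewrite inE; apply: PS; rewrite // setU11.
have [hxP cxP] := cliqueU1_nbr Gsym Girr hP Px.
exists (x |: P); split=> //; first by rewrite cxP cP.
- by move=> p; rewrite !inE => /predU1P[->|/PB].
- move=> p; rewrite !inE => /predU1P[->|/PJ ->]; last by rewrite orbT.
  by rewrite cx eqxx.
- move=> p s; rewrite !inE => /predU1P[->|pP] sS; first exact: Sx.
  by apply: PS; rewrite // !inE sS orbT.
Qed.

(** * Destroying missing pairs that have a common clique *)

Section Cover.
Variables (B L : {set V}) (d : nat).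
Hypotheses (cardB : #|B| <= d)
  (LB : forall v, v \in L -> v \notin B)
  (Ld : forall v, v \in L -> #|miss v| <= d)
  (Bin : forall u v, u \notin B -> v \notin B -> G u v -> c u != c v).

(** [X] is to be the common neighbourhood of the vertices branched on so far, and [m] the number of
    vertices left in the common clique. *)
Definition bad_pair (X : {set V}) (m : nat) (u v : V) : bool :=
  [&& u \in L :&: X, v \in L :&: X, ~~ G u v &
    [exists P : {set V}, [&& clique G P, P \subset X, P \subset nbr G u,
                             P \subset nbr G v & #|P| == m]]].

(** A vertex of [Y] that sees [P] and is adjacent to [v] would give a clique on [m + 2] vertices in
    [X]. So all counted vertices form missing pairs with [v]. *)
Lemma card_seeing_witness m (X Y P : {set V}) i j v : i != j ->
  (forall Q, clique G Q -> Q \subset X -> #|Q| <= m.+1) ->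
  (forall y, y \in Y -> y \in X /\ c y = i) ->
  v \in L :&: X -> c v = j ->
  clique G P -> P \subset X -> P \subset nbr G v -> #|P| = m ->
  #|[set y in Y | P \subset nbr G y]| <= d.
Proof.
move=> ij Xm YX /setIP[vL vX] cv hP PX Pv cP.
apply: leq_trans (Ld vL); apply: subset_leq_card; apply/subsetP => y.
rewrite inE => /andP[/YX[yX cy] Py]; rewrite inE /cdiff cv cy eq_sym ij /=.
apply/negP => Gvy.
have [hvP cvP] := cliqueU1_nbr Gsym Girr hP Pv.
have yvP : v |: P \subset nbr G y by rewrite subUset sub1set Py inE Gsym Gvy.
have [hQ cQ] := cliqueU1_nbr Gsym Girr hvP yvP.
have : #|y |: (v |: P)| <= m.+1.
  by apply: Xm => //; rewrite !subUset !sub1set yX vX.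
by rewrite cQ cvP cP ltnn.
Qed.

(** Double counting: each [y] in [Y] has at most [d] non-neighbours of another colour. *)
Lemma card_heavy m (Y : {set V}) i :
  Y \subset L -> (forall y, y \in Y -> c y = i) -> 0 < #|Y| ->
  #|[set p | (c p != i) && (#|Y| <= 2 * m * #|[set y in Y | ~~ G y p]|)]|
    <= 2 * m * d.
Proof.
move=> /subsetP YL Yi Y0; set Z := [set _ | _].
rewrite -(leq_pmul2r Y0) -sum_nat_const.
apply: (@leq_trans (\sum_(p in Z) 2 * m * #|[set y in Y | ~~ G y p]|)).
  by apply: leq_sum => p; rewrite inE => /andP[].
rewrite -big_distrr /= -!mulnA !leq_mul2l /=; apply/orP; right.
have -> : \sum_(p in Z) #|[set y in Y | ~~ G y p]| =
    \sum_(y in Y) #|[set p in Z | ~~ G y p]|.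
  under eq_bigr do rewrite -sum1_card.
  under [RHS]eq_bigr do rewrite -sum1_card.
  rewrite (exchange_big_dep (mem Y)) /=; last first.
    by move=> p y _; rewrite inE => /andP[].
  by apply: eq_bigr => y yY; apply: eq_bigl => p; rewrite !inE yY.
rewrite mulnC -sum_nat_const; apply: leq_sum => y yY.
apply: leq_trans (Ld (YL _ yY)); apply: subset_leq_card; apply/subsetP => p.
by rewrite !inE /cdiff (Yi _ yY) eq_sym => /andP[/andP[-> _] ->].
Qed.

(* The bad pairs of two given colours can be destroyed by deleting few
   vertices. If the set [Y] of first components is large, then for each witness
   [P] disjoint from [B] only [d] vertices of [Y] see all of [P], so some vertex
   of [P] misses a fixed fraction of [Y]; by double counting only [O(d)]
   vertices do, and one recurses in the neighbourhood of each of them and of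
   each vertex of [B]. *)
Lemma cover_bad_pairs m (X : {set V}) i j : i != j ->
  (forall Q, clique G Q -> Q \subset X -> #|Q| <= m.+1) ->
  exists D : {set V}, #|D| <= cover_const m * d ^ m.+1 /\
    forall u v, bad_pair X m u v -> c u = i -> c v = j ->
      (u \in D) || (v \in D).
Proof.
move=> ij; elim: m X => [|m IH] X Xm.
  pose Y := [set u | (c u == i) && [exists v, (c v == j) && bad_pair X 0 u v]].
  exists Y; split; last first.
    move=> u v uv cu cv; rewrite inE cu eqxx /=.
    by apply/orP; left; apply/existsP; exists v; rewrite cv eqxx.
  have [->|[u0]] := set_0Vmem Y; first by rewrite cards0.
  rewrite inE => /andP[_ /existsP[v /andP[/eqP cv /and4P[_ vX _ _]]]].
  have YX y : y \in Y -> y \in X /\ c y = i.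
    rewrite inE => /andP[/eqP -> /existsP[w /andP[_ /and4P[]]]].
    by rewrite inE => /andP[].
  have := card_seeing_witness ij Xm YX vX cv (clique0 G) (sub0set _) (sub0set _)
    (cards0 V).
  have -> : [set y in Y | set0 \subset nbr G y] = Y.
    by apply/setP => y; rewrite inE sub0set andbT.
  by rewrite expn1 /=; lia.
pose Y := [set u | (c u == i) && [exists v, (c v == j) && bad_pair X m.+1 u v]].
have YLX y : y \in Y -> [/\ y \in L, y \in X & c y = i].
  rewrite inE => /andP[/eqP -> /existsP[w /andP[_ /and4P[]]]].
  by rewrite inE => /andP[].
have [smallY|bigY] := leqP #|Y| (2 * d).
  exists Y; split; last first.
    move=> u v uv cu cv; rewrite inE cu eqxx /=.
    by apply/orP; left; apply/existsP; exists v; rewrite cv eqxx.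
  apply: leq_trans smallY _; rewrite leq_mul ?cover_const_ge2 //.
  by rewrite expnS; case: (posnP d) => [->//|d0]; rewrite leq_pmulr ?expn_gt0 ?d0.
pose Z := [set p | (c p != i) &&
  (#|Y| <= 2 * m.+1 * #|[set y in Y | ~~ G y p]|)].
have cardZ : #|Z| <= 2 * m.+1 * d.
  apply: card_heavy; last by lia.
    by apply/subsetP => y /YLX[].
  by move=> y /YLX[].
have /fin_all_exists[D DP] : forall p, exists D : {set V}, p \in X ->
    #|D| <= cover_const m * d ^ m.+1 /\
    forall u v, bad_pair (X :&: nbr G p) m u v -> c u = i -> c v = j ->
      (u \in D) || (v \in D).
  move=> p; have [pX|_] := boolP (p \in X); last by exists set0.
  have [|D DP] := IH (X :&: nbr G p); last by exists D.
  move=> Q hQ; rewrite subsetI => /andP[QX Qp].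
  have [hpQ cpQ] := cliqueU1_nbr Gsym Girr hQ Qp.
  by rewrite -ltnS -cpQ; apply: Xm; rewrite // subUset sub1set pX.
exists (\bigcup_(p in (Z :|: B) :&: X) D p); split.
  apply: (@leq_trans (\sum_(p in (Z :|: B) :&: X) cover_const m * d ^ m.+1)).
    elim/big_ind2: _ => [|A a A' a' hA hA'|p]; first by rewrite cards0.
      by rewrite cardsU; apply: leq_trans (leq_subr _ _) _; rewrite leq_add.
    by rewrite inE => /andP[_ /DP[]].
  rewrite sum_nat_const.
  apply: (@leq_trans ((2 * m.+1 + 1) * d * (cover_const m * d ^ m.+1))).
    rewrite leq_mul2r; apply/orP; right.
    apply: leq_trans (subset_leq_card (subsetIl _ _)) _.
    rewrite cardsU; apply: leq_trans (leq_subr _ _) _.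
    by rewrite mulnDl mul1n leq_add.
  by rewrite /= (expnS d m.+1); apply: eq_leq; ring.
move=> u v uv cu cv; have := uv => /and4P[uLX vLX Guv /existsP[P]].
move=> /and5P[hP PX Pu Pv /eqP cP].
have uY : u \in Y.
  by rewrite inE cu eqxx /=; apply/existsP; exists v; rewrite cv eqxx.
(* Without [p] the witness lies in the neighbourhood of [p], as do [u] and [v], so the pair is bad
   one level down. *)
have branch p : p \in P -> p \in Z :|: B ->
    (u \in \bigcup_(p in (Z :|: B) :&: X) D p) ||
    (v \in \bigcup_(p in (Z :|: B) :&: X) D p).
  move=> pP pZB; have pX := subsetP PX p pP.
  have [_ Dp] := DP p pX.
  have sub q : q \in D p -> q \in \bigcup_(p in (Z :|: B) :&: X) D p.
    by move=> qD; apply/bigcupP; exists p; rewrite // inE pZB.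
  have up : u \in nbr G p by have := subsetP Pu p pP; rewrite !inE Gsym.
  have vp : v \in nbr G p by have := subsetP Pv p pP; rewrite !inE Gsym.
  suff : bad_pair (X :&: nbr G p) m u v.
    by move=> /Dp /(_ cu cv) /orP[/sub ->|/sub ->]; rewrite ?orbT.
  apply/and4P; split=> //.
  - by rewrite setIA inE uLX.
  - by rewrite setIA inE vLX.
  apply/existsP; exists (P :\ p); have sP : P :\ p \subset P by apply: subD1set.
  apply/and5P; split; [exact: sub_clique hP| |exact: subset_trans Pu|
    exact: subset_trans Pv|].
    rewrite subsetI (subset_trans sP PX) /=; apply/subsetP => q.
    rewrite !inE => /andP[qp qP]; apply: (cliqueP _ _ hP) => //.
    by rewrite eq_sym.
  by move: cP; rewrite (cardsD1 p) pP add1n => -[->].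
have [[p pP pB]|PB] : (exists2 p, p \in P & p \in B) \/
    (forall p, p \in P -> p \notin B).
    have [/existsP[p /andP[]]|] := boolP [exists p, (p \in P) && (p \in B)].
      by left; exists p.
    rewrite negb_exists => /forallP h; right => p pP.
    by have := h p; rewrite pP.
  by apply: (branch p pP); rewrite inE pB orbT.
have [/existsP[p /andP[pP pZ]]|nZ] := boolP [exists p, (p \in P) && (p \in Z)].
  by apply: (branch p pP); rewrite inE pZ.
(* Now each of the [m.+1] vertices of [P] misses less than a [1 / (2 * m.+1)] share of [Y], so
   together they miss at most half of it. At most [d] vertices of [Y] see all of [P], hence
   [#|Y| <= 2 * d], a contradiction. *)
exfalso; have nZ' p : p \in P ->
    2 * m.+1 * #|[set y in Y | ~~ G y p]| < #|Y|.
  move=> pP; move: nZ; rewrite negb_exists => /forallP/(_ p).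
  rewrite pP inE /= ltnNge; apply: contra => ->; rewrite andbT.
  have [uL _ _] := YLX u uY.
  rewrite -cu eq_sym; apply: Bin; [exact: LB|exact: PB|].
  by have := subsetP Pu p pP; rewrite inE.
have YX y : y \in Y -> y \in X /\ c y = i by move=> /YLX[].
have seen := card_seeing_witness ij Xm YX vLX cv hP PX Pv cP.
have : #|Y| <= d + \sum_(p in P) #|[set y in Y | ~~ G y p]|.
  apply: leq_trans (leq_add seen (leqnn _)).
  apply: (@leq_trans #|[set y in Y | P \subset nbr G y] :|:
      \bigcup_(p in P) [set y in Y | ~~ G y p]|).
    apply: subset_leq_card; apply/subsetP => y yY; rewrite inE.
    have [Py|/subsetPn[p pP]] := boolP (P \subset nbr G y).
      by rewrite inE yY Py.
    rewrite [p \in _]inE => Gyp; apply/orP; right; apply/bigcupP; exists p => //.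
    by rewrite inE yY Gyp.
  rewrite cardsU; apply: leq_trans (leq_subr _ _) _; rewrite leq_add2l.
  elim/big_ind2: _ => [|A a A' a' hA hA'|//]; first by rewrite cards0.
  by rewrite cardsU; apply: leq_trans (leq_subr _ _) _; rewrite leq_add.
have : 2 * m.+1 * \sum_(p in P) #|[set y in Y | ~~ G y p]| <= m.+1 * #|Y|.
  rewrite big_distrr /= -cP -sum_nat_const; apply: leq_sum => p pP.
  by rewrite cP; apply: ltnW; apply: nZ'.
rewrite [2 * _]mulnC -mulnA leq_pmul2l // => le2 le1; move: bigY le1 le2.
by move: #|Y| (\sum_(p in P) _) => y s; clear; lia.
Qed.

End Cover.
End Missing.

(** * Saturated hypergraphs *)

(** The 2-shadow of [H]. *)
Definition adj (V : finType) (H : {set {set V}}) : rel V :=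
  fun u v => (u != v) && [exists e in H, (u \in e) && (v \in e)].

Section Saturated.
Variables (V : finType) (r l : nat).
Implicit Types (H : {set {set V}}) (K : {set V}).

Lemma adj_sym H : symmetric (adj H).
Proof.
move=> u v; rewrite /adj eq_sym; congr (_ && _).
by apply: eq_existsb => e; rewrite [(u \in e) && _]andbC.
Qed.

Lemma adj_irr H : irreflexive (adj H).
Proof. by move=> u; rewrite /adj eqxx. Qed.

(** One edge per pair of [K] covers all pairs, which respects the bound ['C(#|K|, 2)]. *)
Lemma clique_contains_K H K : is_rgraph r H -> clique (adj H) K ->
  contains_K_member r #|K| H.
Proof.
move=> rH /cliqueP hK.
(* The default [set0] is never taken on pairs from [K]. *)
pose f (A : {set V}) := odflt set0 [pick e in H | A \subset e].
pose F := f @: [set A : {set V} | A \subset K & #|A| == 2].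
have fP u v : u \in K -> v \in K -> u != v ->
    f [set u; v] \in H /\ [set u; v] \subset f [set u; v].
  move=> uK vK uv; rewrite /f; case: pickP => [e /andP[eH se]|/= none]; first by [].
  have /andP[_ /existsP[e /and3P[eH ue ve]]] := hK u v uK vK uv.
  by have := none e; rewrite eH subUset !sub1set ue ve.
have FH e : e \in F -> e \in H.
  case/imsetP=> A; rewrite inE => /andP[AK /cards2P[u [v [uv AE]]]] ->.
  move: AK; rewrite AE subUset !sub1set => /andP[uK vK].
  by have [] := fP u v uK vK uv.
exists V, F; split; last first.
  by exists id => // e /FH; rewrite imset_id.
split; first by move=> e /FH /rH.
  by rewrite -cards_draws leq_imset_card.
exists K; split=> // u v uK vK uv; have [_ sub] := fP u v uK vK uv.
exists (f [set u; v]); split.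
- by apply: imset_f; rewrite inE subUset !sub1set uK vK cards2 uv.
- by apply: (subsetP sub); rewrite !inE eqxx.
- by apply: (subsetP sub); rewrite !inE eqxx orbT.
Qed.

Lemma contains_K_clique H k : contains_K_member r k H ->
  exists K, clique (adj H) K /\ #|K| = k.
Proof.
case=> W [F [[_ _ [S [cS Spair]]] [f finj fF]]].
exists (f @: S); split; last by rewrite card_imset.
apply/cliqueP => _ _ /imsetP[a aS ->] /imsetP[b bS ->] fab.
have ab : a != b by apply: contraNneq fab => ->.
have [e [eF ae be]] := Spair a b aS bS ab.
rewrite /adj fab; apply/existsP; exists (f @: e).
by rewrite fF // !imset_f.
Qed.

Variable H : {set {set V}}.
Hypotheses (rH : is_rgraph r H) (satH : K_saturated r l.+1 H).

Lemma saturated_clique_le K : clique (adj H) K -> #|K| <= l.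
Proof.
move=> hK; rewrite leqNgt; apply/negP => lK.
have : 0 < #|[set A : {set V} | A \subset K & #|A| == l.+1]|.
  by rewrite cards_draws bin_gt0.
case/card_gt0P=> A; rewrite inE => /andP[AK /eqP cA].
apply: satH.1; rewrite -cA; apply: clique_contains_K => //.
exact: sub_clique hK.
Qed.

Lemma saturated_add (e : {set V}) : #|e| = r -> e \notin H -> exists K,
  #|K| = l.+1 /\ {in K &, forall u v, u != v ->
    adj H u v || ((u \in e) && (v \in e))}.
Proof.
move=> er eH; have [K [/cliqueP hK cK]] := contains_K_clique (satH.2 e er eH).
exists K; split=> // u v uK vK uv.
have /andP[_ /existsP[e' /and3P[]]] := hK u v uK vK uv.
rewrite inE => /orP[/set1P -> -> ->|e'H ue ve]; first by rewrite orbT.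
by apply/orP; left; rewrite /adj uv; apply/existsP; exists e'; rewrite e'H ue.
Qed.

(** Adding an [r]-clique [e] of the shadow makes no new pair adjacent, so the core it would create
    is already a clique on [l + 1] vertices. *)
Lemma saturated_cliques : H = cliques (adj H) r.
Proof.
apply/setP => e; rewrite inE; apply/idP/andP => [eH|[he /eqP er]].
  rewrite rH //; split=> //; apply/cliqueP => u v ue ve uv.
  by rewrite /adj uv; apply/existsP; exists e; rewrite eH ue.
apply/negPn/negP => eH; have [K [cK hK]] := saturated_add er eH.
suff /saturated_clique_le : clique (adj H) K by rewrite cK ltnn.
apply/cliqueP => u v uK vK uv; have /orP[//|/andP[ue ve]] := hK u v uK vK uv.
exact: (cliqueP _ _ he).
Qed.

(** The new edge made of [u], [v] and [P] makes only the pair [u], [v] newly adjacent. So the core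
    it creates contains both, and its other [l - 1] vertices form [Q]. *)
Lemma saturated_common_clique u v P : 2 <= r -> u != v -> ~~ adj H u v ->
  clique (adj H) P -> #|P| = r - 2 ->
  P \subset nbr (adj H) u -> P \subset nbr (adj H) v ->
  exists Q, [/\ clique (adj H) Q, #|Q| = l.-1,
    Q \subset nbr (adj H) u & Q \subset nbr (adj H) v].
Proof.
move=> r2 uv nuv hP cP Pu Pv; pose e := u |: (v |: P).
have vP := notin_sub_nbr (adj_irr H) Pv.
have uP := notin_sub_nbr (adj_irr H) Pu.
have uvP : u \notin v |: P by rewrite !inE negb_or uv.
have er : #|e| = r by rewrite /e !cardsU1 uvP vP cP; lia.
have eH : e \notin H.
  apply: contra nuv => eH; rewrite /adj uv; apply/existsP; exists e.
  by rewrite eH !inE !eqxx orbT.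
have [K [cK hK]] := saturated_add er eH.
have new a b : a \in K -> b \in K -> a != b -> ~~ adj H a b ->
    (a == u) && (b == v) || (a == v) && (b == u).
  move=> aK bK ab nab; have := hK a b aK bK ab; rewrite (negPf nab) /= !inE.
  have adjP p q : p \in P -> q \in P -> p != q -> adj H p q.
    by move=> pP qP; apply: (cliqueP _ _ hP).
  have adju p : p \in P -> adj H u p by move=> /(subsetP Pu); rewrite inE.
  have adjv p : p \in P -> adj H v p by move=> /(subsetP Pv); rewrite inE.
  move=> /andP[/or3P[/eqP au|/eqP av|aP] /or3P[/eqP bu|/eqP bv|bP]].
  - by rewrite au bu eqxx in ab.
  - by rewrite au bv !eqxx.
  - by rewrite au adju in nab.
  - by rewrite av bu !eqxx orbT.
  - by rewrite av bv eqxx in ab.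
  - by rewrite av adjv in nab.
  - by rewrite bu adj_sym adju in nab.
  - by rewrite bv adj_sym adjv in nab.
  - by rewrite adjP in nab.
have /andP[uK vK] : (u \in K) && (v \in K).
  apply/negPn/negP => nK.
  suff /saturated_clique_le : clique (adj H) K by rewrite cK ltnn.
  apply/cliqueP => a b aK bK ab; apply/negPn/negP => nab.
  by have /orP[] := new a b aK bK ab nab => /andP[/eqP ea /eqP eb];
    move: nK; rewrite -ea -eb aK bK.
have vKu : v \in K :\ u by rewrite !inE eq_sym uv.
exists (K :\ u :\ v); split.
- apply/cliqueP => a b; rewrite !inE => /and3P[av au aK] /and3P[bv bu bK] ab.
  apply/negPn/negP => nab; have := new a b aK bK ab nab.
  by rewrite (negPf au) (negPf av).
- by move: cK; rewrite (cardsD1 u) uK (cardsD1 v) vKu !add1n => -[<-].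
- apply/subsetP => q; rewrite !inE => /and3P[qv qu qK].
  apply/negPn/negP => nq; have := new u q uK qK; rewrite eq_sym qu nq.
  by move=> /(_ isT isT); rewrite (negPf qv) (negPf qu) !andbF.
- apply/subsetP => q; rewrite !inE => /and3P[qv qu qK].
  apply/negPn/negP => nq; have := new v q vK qK; rewrite eq_sym qv nq.
  by move=> /(_ isT isT); rewrite (negPf qv) (negPf qu) !andbF.
Qed.

End Saturated.

(** * Deleting vertices to reach a complete multipartite graph *)

Section Assembly.
Variables (V : finType) (G : rel V) (l r : nat) (c : V -> 'I_l).
Hypotheses (Gsym : symmetric G) (Girr : irreflexive G).
Hypotheses (r2 : 2 <= r) (rl : r <= l).
Hypothesis Gl : forall K, clique G K -> #|K| <= l.
Hypothesis Gsat : forall u v (P : {set V}), u != v -> ~~ G u v ->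
  clique G P -> #|P| = r - 2 -> P \subset nbr G u -> P \subset nbr G v ->
  exists Q, [/\ clique G Q, #|Q| = l.-1, Q \subset nbr G u & Q \subset nbr G v].
Variables (h d : nat).
Let B := [set v | h < #|miss G c v|].
Hypothesis big : forall j, #|B| + l.+1 * h < color_size c j.
Hypothesis Bd : #|B| <= d.

Let Bh v : v \notin B -> #|miss G c v| <= h.
Proof. by rewrite inE -leqNgt. Qed.

(** [greedy_clique] would extend a monochromatic edge by one vertex of each other colour to a clique
    on [l + 1] vertices. *)
Lemma no_inner_edge u v : u \notin B -> v \notin B -> G u v -> c u != c v.
Proof.
move=> uB vB Guv; apply/negP => /eqP cuv.
have uv : u != v by apply: contraTneq Guv => ->; rewrite Girr.
have sJ : size (rem (c u) (enum 'I_l)) = l.-1.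
  by rewrite size_rem ?mem_enum // -cardE card_ord.
have [|||j _|P [hP cP _ _ PS]] := greedy_clique Gsym Girr (S := [set u; v])
  (J := rem (c u) (enum 'I_l)) Bh.
- by move=> x /set2P[] ->.
- by apply: rem_uniq; apply: enum_uniq.
- by move=> x /set2P[] ->; rewrite -?cuv mem_rem_uniqF ?enum_uniq.
- have := big j; rewrite sJ cards2 uv /color_size.
  by have -> : 1 + true + l.-1 = l.+1 by lia.
have Pv : P \subset nbr G v.
  by apply/subsetP => p pP; rewrite inE PS // !inE eqxx orbT.
have [hvP cvP] := cliqueU1_nbr Gsym Girr hP Pv.
have Pu : v |: P \subset nbr G u.
  rewrite subUset sub1set inE Guv /=; apply/subsetP => p pP.
  by rewrite inE PS // !inE eqxx.
have [hQ cQ] := cliqueU1_nbr Gsym Girr hvP Pu.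
have := Gl hQ; rewrite cQ cvP cP sJ prednK ?ltnn //.
by apply: leq_trans rl; apply: ltnW.
Qed.

(** [greedy_clique] with [r - 2] of the [l - 2] colours other than those of [u] and [v]. *)
Lemma exists_common_clique u v : u \notin B -> v \notin B -> c u != c v ->
  exists P : {set V}, [/\ clique G P, #|P| = r - 2,
    P \subset nbr G u & P \subset nbr G v].
Proof.
move=> uB vB cuv; have uv : u != v by apply: contraNneq cuv => ->.
pose J := take (r - 2) (rem (c v) (rem (c u) (enum 'I_l))).
have uJ : uniq (rem (c v) (rem (c u) (enum 'I_l))).
  by rewrite !rem_uniq ?enum_uniq.
have sJ : size J = r - 2.
  rewrite size_takel // !size_rem ?mem_enum ?mem_rem_uniq ?enum_uniq //.
    by rewrite -cardE card_ord; lia.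
  by rewrite inE eq_sym cuv mem_enum.
have [|||j _|P [hP cP _ _ PS]] := greedy_clique Gsym Girr (S := [set u; v])
  (J := J) Bh.
- by move=> x /set2P[] ->.
- exact: take_uniq.
- move=> x xS; apply/negP => /mem_take; rewrite mem_rem_uniq ?rem_uniq ?enum_uniq //.
  rewrite inE mem_rem_uniq ?enum_uniq // inE.
  by case/set2P: xS => ->; rewrite eqxx ?andbF.
- apply: leq_ltn_trans (big j); rewrite leq_add2l leq_mul2r sJ cards2 uv.
  by apply/orP; right; lia.
exists P; split=> //; first by rewrite cP.
- by apply/subsetP => p pP; rewrite inE PS // !inE eqxx.
- by apply/subsetP => p pP; rewrite inE PS // !inE eqxx orbT.
Qed.

(** Deleted are [B], the vertices of missing degree above [d], and a cover from [cover_bad_pairs]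
    for each ordered pair of colours and each [b] in [B]. A surviving missing pair would have a
    common clique on [l - 1] vertices, and this meets [B]: outside [B] its vertices would have
    distinct colours among the [l - 2] different from [c u] and [c v]. *)
Lemma exists_complete_multipartite : exists U : {set V},
  #|~: U| <= #|B| + #|[set v | d < #|miss G c v|]|
    + l ^ 2 * #|B| * (cover_const (l - 2) * d ^ l.-1) /\
  {in U &, forall u v, c u != c v -> G u v}.
Proof.
pose D1 := [set v | d < #|miss G c v|].
pose L := ~: (B :|: D1).
have LB v : v \in L -> v \notin B by rewrite !inE negb_or => /andP[].
have Ld v : v \in L -> #|miss G c v| <= d.
  by rewrite !inE negb_or -!leqNgt => /andP[].
have l2 : (l - 2).+1 = l.-1 by lia.
have /fin_all_exists[D DP] : forall t : 'I_l * 'I_l * V,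
  exists D : {set V}, #|D| <= cover_const (l - 2) * d ^ l.-1 /\
    forall u v, t.1.1 != t.1.2 -> bad_pair G L (nbr G t.2) (l - 2) u v ->
      c u = t.1.1 -> c v = t.1.2 -> (u \in D) || (v \in D).
  case=> [[i j] b] /=; have [_|ij] := eqVneq i j.
    by exists set0; rewrite cards0.
  have [|D [cD DP]] := cover_bad_pairs Gsym Girr Bd LB Ld no_inner_edge
      (m := l - 2) (X := nbr G b) ij.
    move=> Q hQ Qb; have [hbQ cbQ] := cliqueU1_nbr Gsym Girr hQ Qb.
    by rewrite l2; have := Gl hbQ; rewrite cbQ; lia.
  by exists D; rewrite -l2; split=> // u v _; apply: DP.
pose T := setX [set: 'I_l * 'I_l] B.
pose D2 := \bigcup_(t in T) D t.
exists (~: (B :|: D1 :|: D2)); split.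
  rewrite setCK; apply: leq_trans (leq_card_setU _ _).1 _; apply: leq_add.
    exact: (leq_card_setU _ _).1.
  apply: (@leq_trans (\sum_(t in T) cover_const (l - 2) * d ^ l.-1)).
    rewrite /D2; elim/big_ind2: _ => [|A a A' a' hA hA'|t _].
    - by rewrite cards0.
    - by apply: leq_trans (leq_card_setU _ _).1 _; apply: leq_add.
    - by have [] := DP t.
  by rewrite sum_nat_const cardsX cardsT card_prod card_ord mulnn.
move=> u v; rewrite !in_setC !in_setU !negb_or.
move=> /andP[/andP[uB uD1] uD2] /andP[/andP[vB vD1] vD2] cuv.
apply/negPn/negP => nuv.
have uv : u != v by apply: contraNneq cuv => ->.
have [P [hP cP Pu Pv]] := exists_common_clique uB vB cuv.
have [Q [hQ cQ Qu Qv]] := Gsat uv nuv hP cP Pu Pv.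
have [/existsP[b /andP[bQ bB]]|nB] := boolP [exists b, (b \in Q) && (b \in B)].
  have [_ /(_ u v)] := DP (c u, c v, b); rewrite /= cuv.
  have sub w : w \in D (c u, c v, b) -> w \in D2.
    by move=> wD; apply/bigcupP; exists (c u, c v, b); rewrite // inE /= inE bB.
  (* For [b] in [Q] the pair is bad in the neighbourhood of [b], with witness [Q :\ b]. *)
  suff bad : bad_pair G L (nbr G b) (l - 2) u v.
    by move=> /(_ isT bad erefl erefl) /orP[/sub|/sub]; apply/negP.
  have ub : G b u by have := subsetP Qu b bQ; rewrite inE Gsym.
  have vb : G b v by have := subsetP Qv b bQ; rewrite inE Gsym.
  have sQ : Q :\ b \subset Q by apply: subD1set.
  apply/and4P; split=> //.
  - by rewrite in_setI in_setC in_setU negb_or uB uD1 inE.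
  - by rewrite in_setI in_setC in_setU negb_or vB vD1 inE.
  apply/existsP; exists (Q :\ b); apply/and5P; split.
  - exact: sub_clique hQ.
  - apply/subsetP => q; rewrite !inE => /andP[qb qQ].
    by apply: (cliqueP _ _ hQ); rewrite // eq_sym.
  - exact: subset_trans Qu.
  - exact: subset_trans Qv.
  - by apply/eqP; move: cQ; rewrite (cardsD1 b) bQ => e; move: rl r2 e; clear; lia.
have QB q : q \in Q -> q \notin B.
  by move=> qQ; move: nB; rewrite negb_exists => /forallP/(_ q); rewrite qQ.
have cinj : {in Q &, injective c}.
  move=> p q pQ qQ cpq; apply/eqP/negPn/negP => pq.
  have := no_inner_edge (QB p pQ) (QB q qQ) (cliqueP _ _ hQ p q pQ qQ pq).
  by rewrite cpq eqxx.
have : #|c @: Q| <= #|~: [set c u; c v]|.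
  apply: subset_leq_card; apply/subsetP => _ /imsetP[q qQ ->].
  have Guq : G u q by have := subsetP Qu q qQ; rewrite inE.
  have Gvq : G v q by have := subsetP Qv q qQ; rewrite inE.
  rewrite !inE negb_or; apply/andP; split; rewrite eq_sym;
    by apply: no_inner_edge => //; apply: QB.
rewrite card_in_imset // cQ; have := cardsC [set c u; c v].
rewrite card_ord cards2 cuv; move: rl r2; clear; lia.
Qed.

End Assembly.

Lemma contains_partite_of_coloring (V : finType) (G : rel V) (r l : nat)
    (c : V -> 'I_l) (U : {set V}) :
  (forall i, exists2 x, x \in U & c x = i) ->
  {in U &, forall u v, c u != c v -> G u v} ->
  contains_complete_partite_on r l (cliques G r) U.
Proof.
move=> csurj UG; pose P i := [set x in U | c x == i]; exists P; split.
  split=> [|i j ij|i].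
  - apply/setP => x; apply/idP/bigcupP => [xU|[i _]]; last by rewrite inE => /andP[].
    by exists (c x); rewrite // inE xU eqxx.
  - rewrite -setI_eq0; apply/eqP/setP => x; rewrite !inE.
    apply/negP => /andP[/andP[_ /eqP xi] /andP[_ /eqP xj]].
    by rewrite -xi -xj eqxx in ij.
  - by have [x xU cx] := csurj i; apply/set0Pn; exists x; rewrite inE xU cx eqxx.
rewrite (complete_partite_rainbow r (c := c) (U := U)) //; apply/subsetP => K.
rewrite !inE => /and3P[/cliqueP hK /subsetP KU ->]; rewrite andbT.
by apply/cliqueP => u v uK vK uv; apply: UG; [exact: KU|exact: KU|exact: hK].
Qed.

(** The fallback when the required number of vertices is not positive: every vertex of the clique is
    a part of its own, so no part is empty. *)
Lemma contains_partite_of_clique (V : finType) (G : rel V) (r l : nat)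
    (K : {set V}) : 0 < l -> clique G K -> #|K| = l ->
  contains_complete_partite_on r l (cliques G r) K.
Proof.
move=> l0 /cliqueP hK cK.
have [x0 x0K] : exists x, x \in K by apply/set0Pn; rewrite -card_gt0 cK.
apply: (@contains_partite_of_coloring _ _ _ _
  (fun x => cast_ord cK (enum_rank_in x0K x))).
  move=> i; exists (enum_val (cast_ord (esym cK) i)); first exact: enum_valP.
  by rewrite enum_valK_in cast_ordKV.
move=> u v uK vK cuv; apply: hK => //.
by apply: contraNneq cuv => ->.
Qed.

(** The integer core of the theorem, with the threshold [d] left free. [M] counts missing pairs, [b]
    is the size of the exceptional set and [e] the number of vertices of missing degree above [d];
    the last condition keeps a vertex of each colour. *)
Lemma saturated_structure (V : finType) (H : {set {set V}}) (l k : nat) :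
  let r := k.+2 in let n := #|V| in let t := turan_number r n l in
  r <= l -> is_rgraph r H -> K_saturated r l.+1 H ->
  33 * l ^ 2 * (t - #|H|) < t -> 4 * l <= n ->
  exists M, M * t <= 4 * r ^ 2 * n ^ 2 * (t - #|H|) /\
    forall d, 16 * l ^ 2 * l.+1 * M <= n ^ 2 -> 4 * l * l.+1 * M <= d * n ->
    exists (U : {set V}) (b e : nat),
      [/\ b * n <= 4 * l * l.+1 * M, e * d.+1 <= M,
          #|~: U| <= b + e + l ^ 2 * b * (cover_const (l - 2) * d ^ l.-1) &
          2 * l * #|~: U| <= n -> contains_complete_partite_on r l H U].
Proof.
move=> r n t rl rH satH tN nl.
have l0 : 0 < l by apply: leq_trans rl.
have n0 : 0 < n by apply: leq_trans nl; rewrite muln_gt0.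
have Gsym := adj_sym H; have Girr := adj_irr H.
have HE := saturated_cliques rH satH.
have Gl := saturated_clique_le rH satH.
have [c [_ NE]] := leq_cliques_elsym k Gsym Girr (leqnn l) Gl.
rewrite HE in tN *.
have Mle := leq_card_missing l0 tN NE.
have csize i := color_size_gt l0 i tN nl (leq_trans (leq_addr _ _) NE).
exists #|missing (adj H) c|; split=> //; set M := #|missing _ _| => d Mn Md.
(* This gives [l.+1 * h <= n / 4l]; with [#|B| <= n / 4l] the sum stays below the class sizes, which
   exceed [n / 2l]. *)
pose h := n %/ (4 * l * l.+1).
pose B := [set v | h < #|miss (adj H) c v|].
have q0 : 0 < 4 * l * l.+1 by rewrite !muln_gt0 l0.
have Bn : #|B| * n <= 4 * l * l.+1 * M.
  have nh : n <= h.+1 * (4 * l * l.+1) by apply: ltnW; rewrite ltn_ceil.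
  apply: leq_trans (leq_mul (leqnn #|B|) nh) _.
  by rewrite mulnA mulnC leq_mul2l card_miss_gt orbT.
have Bd : #|B| <= d by rewrite -(leq_pmul2r n0) (leq_trans Bn).
have B4 : 4 * l * #|B| <= n.
  rewrite -(leq_pmul2r n0) -mulnA; apply: leq_trans (leq_mul (leqnn _) Bn) _.
  by apply: leq_trans Mn; apply: eq_leq; ring.
have h4 : h * (4 * l * l.+1) <= n by apply: leq_divM.
have big j : #|B| + l.+1 * h < color_size c j.
  have l40 : 0 < 4 * l by rewrite muln_gt0.
  rewrite -(ltn_pmul2l l40); have := csize j; move: B4 h4; clear.
  move: #|B| (color_size c j) => b a; lia.
have [U [cU UG]] := exists_complete_multipartite Gsym Girr (isT : 1 < r) rl Gl
  (fun u v P uv nuv hP cP Pu Pv =>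
     saturated_common_clique rH satH isT uv nuv hP cP Pu Pv) big Bd.
exists U, #|B|, #|[set v | d < #|miss (adj H) c v|]|; split=> //.
  exact: card_miss_gt.
move=> Usmall; apply: contains_partite_of_coloring UG => i.
have : ~~ ([set x in [set: V] | c x == i] \subset ~: U).
  apply/negP => /subset_leq_card le.
  have : 2 * l * color_size c i <= n.
    by apply: leq_trans Usmall; rewrite leq_mul2l le orbT.
  by rewrite leqNgt csize.
by case/subsetPn=> x; rewrite !inE /= negbK => /eqP cx xU; exists x.
Qed.

(** * Real estimates and choice of constants *)

Local Open Scope ring_scope.

(** Turns the real exponents into natural powers of [s], the [l]-th root of [n]. *)
Lemma nat_root_powR (R : realType) (n l : nat) : (0 < n)%N -> (0 < l)%N ->
  let s : R := n%:R `^ l%:R^-1 in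
  [/\ 1 <= s, s ^+ l = n%:R, n%:R `^ (l%:R^-1 - 1) = s / n%:R &
      n%:R `^ (1 - l%:R^-1) = s ^+ l.-1].
Proof.
move=> n0 l0 s.
have n0R : 0 < n%:R :> R by rewrite ltr0n.
have l0R : l%:R != 0 :> R by rewrite pnatr_eq0 -lt0n.
have s0 : 0 < s by rewrite powR_gt0.
have sl : s ^+ l = n%:R.
  by rewrite -powR_mulrn ?ltW // -powRrM mulVf // powRr1 // ltW.
have n1 : n%:R != 0 :> R by rewrite gt_eqF.
split=> //.
- rewrite -(powRr0 n%:R) ler_powR ?invr_ge0 ?ler0n //.
  by rewrite (ler_nat _ 1).
- by rewrite powRD ?n1 ?implybT // powRN powRr1 ?ltW.
- rewrite powRD ?n1 ?implybT // powRN powRr1 ?ltW // -/s -{1}sl.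
  by rewrite -[in LHS](prednK l0) exprSr mulfK // gt_eqF.
Qed.

Theorem theorem3p1 (R : realType) (l : nat) :
  exists C : R, 0 < C /\
    forall r : nat, (3 <= r)%N -> (r <= l)%N ->
    forall n : nat, (10 ^+ 20 * l%:R ^+ 20 <= n%:R :> R) ->
    forall eps : R, eps <= n%:R `^ (l%:R^-1 - 1) ->
    forall (V : finType) (H : {set {set V}}),
      #|V| = n -> is_rgraph r H -> K_saturated r l.+1 H ->
      (turan_number r n l)%:R
        - ('C(l, r)%:R * r%:R * eps) / (4 * (l%:R - 1) * l%:R ^+ r.-1)
          * n%:R ^+ r <= (#|H|%:R : R) ->
      exists U : {set V},
        (1 - C * eps * n%:R `^ (1 - l%:R^-1)
           - 10 ^+ 6 * l%:R ^+ 3 * (3 * r%:R - 4) ^+ 3 * eps) * n%:R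
          <= (#|U|%:R : R)
        /\ contains_complete_partite_on r l H U.
Proof.
(* [A * eps * n] will bound [#|B|], as [4 l (l+1) 4 l^3 <= 32 l^5]. The summands of [C0] account for
   [B], for the vertices of large missing degree and for the covers, where [d <= 2 * A * s]. *)
pose A : R := 32 * l%:R ^+ 5.
pose C0 : R := A + 4 * l%:R ^+ 3
  + l%:R ^+ 2 * A * ((cover_const (l - 2))%:R * (2 * A) ^+ l.-1).
have eqle (x z : R) : x = z -> x <= z by move=> ->.
have lge0 : 0 <= l%:R :> R by apply: ler0n.
have A0 : 0 <= A by rewrite mulr_ge0 ?exprn_ge0.
have C00 : 0 <= C0.
  by rewrite !addr_ge0 ?mulr_ge0 ?exprn_ge0 ?ler0n // mulr_ge0.
(* The factor [2 l] keeps the deleted set below [n / 2l]; the [+ 1] makes the constant positive. *)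
exists (2 * l%:R * C0 + 1); split; first by rewrite ltr_wpDl // !mulr_ge0.
move=> [//|[//|k]]; set r := k.+2 => r3 rl n nbig eps epsle V H cV rH satH Hbig.
set big := 10 ^+ 6.
have l3 : (3 <= l)%N by apply: leq_trans rl.
have l3R : 3 <= l%:R :> R by rewrite (ler_nat _ 3).
have rlR : r%:R <= l%:R :> R by rewrite ler_nat.
have r34 : 0 <= 3 * r%:R - 4 :> R.
  by have : 3 <= r%:R :> R by [rewrite (ler_nat _ 3)]; lra.
have l1 : 1 <= l%:R :> R by rewrite (ler_nat _ 1) (leq_trans _ l3).
(* [T] is the square root of the lower bound on [n]; since [eps^2 * n <= 1], this will give
   [eps * T <= 1]. *)
have [T [T0 Tn Tpow]] : exists T : R, [/\ 0 <= T, T ^+ 2 <= n%:R &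
    forall a j, 0 <= a -> a <= 1000 -> (j <= 10)%N -> a * l%:R ^+ j <= T].
  exists (10 ^+ 10 * l%:R ^+ 10); split.
  - by rewrite mulr_ge0 ?exprn_ge0.
  - by rewrite exprMn -!exprM.
  - move=> a j a0 a1000 j10; rewrite ler_pM ?exprn_ge0 ?ler_weXn2l //.
    apply: le_trans a1000 _; rewrite -[1000]/((10 ^ 3)%N%:R) natrX.
    by rewrite ler_weXn2l // (ler_nat _ 1).
have big0 : 0 <= big by apply: exprn_ge0.
clearbody big; move=> {nbig}.
have n10 : (10 * l ^ 2 <= n)%N.
  rewrite -(ler_nat R) natrM natrX; have T1 : 1 <= T.
    by rewrite -[1](mulr1 1) -[X in 1 * X](expr0 l%:R) Tpow // (ler_nat _ 1).
  apply: le_trans (le_trans (Tpow 10 2%N _ _ _) _) Tn => //.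
    by rewrite ler_nat.
  by rewrite ler_peMr.
have n0 : (0 < n)%N.
  by apply: leq_trans n10; rewrite muln_gt0 expn_gt0 (leq_trans _ l3).
have n0R : 0 < n%:R :> R by rewrite ltr0n.
have l0 : (0 < l)%N by apply: leq_trans l3.
have [s1 sl sinv spow] := nat_root_powR R n0 l0.
set s : R := n%:R `^ l%:R^-1 in s1 sl sinv spow.
rewrite {}spow; rewrite {}sinv in epsle.
have s0 : 0 < s by apply: lt_le_trans s1.
have epsn : eps * n%:R <= s by rewrite -ler_pdivlMr.
set t := turan_number r n l in Hbig.
have tlow : 'C(l, r)%:R * n%:R ^+ r <= 2 * (t%:R * l%:R ^+ r) :> R.
  rewrite -!natrX -!natrM ler_nat; apply: leq_turan_number => //.
  by apply: leq_trans n10; rewrite -mulnn mulnA leq_mul // leq_mul.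
have t0 : (0 < t)%N.
  rewrite lt0n; apply/eqP => te; move: tlow; rewrite te mul0r mulr0 leNgt.
  by rewrite mulr_gt0 ?exprn_gt0 // ltr0n bin_gt0.
have t0R : 0 < t%:R :> R by rewrite ltr0n.
have Gsym := adj_sym H; have Girr := adj_irr H.
have HE := saturated_cliques rH satH.
have Gl := saturated_clique_le rH satH.
have Ht : (#|H| <= t)%N.
  by rewrite [in leqLHS]HE /t -cV; apply: leq_cliques_turan.
have lr : l%:R ^+ r = l%:R * l%:R ^+ r.-1 :> R by rewrite -exprS.
have lr0 : 0 < l%:R ^+ r.-1 :> R by rewrite exprn_gt0 // ltr0n.
have den0 : 0 < 4 * (l%:R - 1) * l%:R ^+ r.-1 :> R.
  by rewrite !mulr_gt0 //; lra.
set den : R := 4 * (l%:R - 1) * l%:R ^+ r.-1 in Hbig den0.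
have defE : 'C(l, r)%:R * r%:R * eps / den * n%:R ^+ r =
    eps * (r%:R * ('C(l, r)%:R * n%:R ^+ r / den)) by ring.
rewrite {}defE in Hbig.
have HtR : #|H|%:R <= t%:R :> R by rewrite ler_nat.
(* Otherwise [H] would have more than [t] edges, against [Ht]. *)
have eps0 : 0 <= eps.
  rewrite leNgt; apply/negP => epsneg.
  have : eps * (r%:R * ('C(l, r)%:R * n%:R ^+ r / den)) < 0.
    rewrite nmulr_rlt0 // mulr_gt0 ?ltr0n // divr_gt0 // mulr_gt0 ?exprn_gt0 //.
    by rewrite ltr0n bin_gt0.
  by lra.
(* [tlow] and [2 l <= 4 (l - 1)] absorb the normalization [den], so the deficit is at most a share
   [r * eps] of [t]. *)
have Dle : (t - #|H|)%:R <= r%:R * eps * t%:R :> R.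
  rewrite natrB //; suff : 'C(l, r)%:R * n%:R ^+ r / den <= t%:R.
    move=> le; have : eps * (r%:R * ('C(l, r)%:R * n%:R ^+ r / den)) <=
        eps * (r%:R * t%:R) by rewrite !ler_wpM2l.
    by rewrite mulrA [eps * _]mulrC; lra.
  rewrite ler_pdivrMr //; apply: le_trans tlow _; rewrite lr /den.
  have : 0 <= (t%:R * l%:R ^+ r.-1) * (2 * l%:R - 4) :> R.
    by rewrite !mulr_ge0 //; [exact: ltW|lra].
  by lra.
have eps_small : eps * T <= 1.
  rewrite -(@expr_le1 _ 2) //; last by rewrite mulr_ge0.
  have en1 : eps ^+ 2 * n%:R <= 1.
    rewrite -(ler_pM2r n0R) mul1r -mulrA -expr2 -exprMn.
    apply: (@le_trans _ _ (s ^+ 2)).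
      by rewrite ler_pXn2r // nnegrE ?mulr_ge0 // ltW.
    by rewrite -sl ler_weXn2l // ltnW.
  by apply: le_trans en1; rewrite exprMn ler_wpM2l ?exprn_ge0.
have eps_pow (a : R) j : 0 <= a -> a <= 1000 -> (j <= 10)%N ->
    a * l%:R ^+ j * eps <= 1.
  move=> a0 a10 j10; apply: le_trans eps_small; rewrite mulrC ler_wpM2l //.
  exact: Tpow.
have tN : (33 * l ^ 2 * (t - #|H|) < t)%N.
  rewrite -(ltr_nat R) 2!natrM natrX.
  apply: (@le_lt_trans _ _ (33 * l%:R ^+ 3 * eps * t%:R)).
    have : 33 * l%:R ^+ 2 * (t - #|H|)%:R <=
        33 * l%:R ^+ 2 * (l%:R * eps * t%:R) :> R.
      rewrite ler_wpM2l ?mulr_ge0 ?exprn_ge0 //; apply: le_trans Dle _.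
      by rewrite !ler_wpM2r // ltW.
    by move/le_trans; apply; apply: eqle; ring.
  have e66 : 66 * l%:R ^+ 3 * eps <= 1 by apply: eps_pow; rewrite ?ler_nat.
  by rewrite gtr_pMl //; lra.
have n4 : (4 * l <= n)%N.
  by apply: leq_trans n10; rewrite leq_mul // -mulnn leq_pmulr.
have junk0 : 0 <= big * l%:R ^+ 3 * (3 * r%:R - 4) ^+ 3 * eps.
  by rewrite !mulr_ge0 ?exprn_ge0.
(* In the first case the required number of vertices is not positive and an [l]-clique suffices. *)
have [large|small] := lerP 1 ((2 * l%:R * C0 + 1) * eps * s ^+ l.-1).
  have [||K [hK cK]] := exists_clique_l (k := k) Gsym Girr l0 Gl.
  - by rewrite cV -/r -/t -HE.
  - by rewrite cV.
  exists K; split; last by rewrite HE; apply: contains_partite_of_clique.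
  apply: (@le_trans _ _ 0); last exact: ler0n.
  by rewrite pmulr_lle0 //; lra.
have := saturated_structure rl rH satH; rewrite /= cV -/r -/t.
move=> /(_ tN n4)[M [Mt struct]].
have MleR : M%:R <= 4 * l%:R ^+ 3 * eps * n%:R ^+ 2.
  rewrite -(ler_pM2r t0R); move: Mt; rewrite -(ler_nat R) 4!natrM 2!natrX.
  move/le_trans; apply.
  apply: (@le_trans _ _ (4 * l%:R ^+ 2 * n%:R ^+ 2 * (l%:R * eps * t%:R))).
    rewrite ler_pM ?mulr_ge0 ?exprn_ge0 //.
      by rewrite ler_wpM2r ?exprn_ge0 // ler_wpM2l // ler_pXn2r // nnegrE.
    by apply: le_trans Dle _; rewrite !ler_wpM2r // ltW.
  by apply: eqle; ring.
(* An integer between [A * s] and [2 * A * s]; the lower bound and [eps * n <= s] give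
   [#|B| <= d]. *)
pose d := (32 * l ^ 5 * (Num.truncn s).+1)%N.
have dE : d%:R = A * (Num.truncn s).+1%:R :> R by rewrite 2!natrM natrX.
have dge : A * s <= d%:R.
  by rewrite dE ler_wpM2l // ltW // truncnS_gt.
have dle : d%:R <= 2 * A * s.
  have -> : 2 * A * s = A * (2 * s) by ring.
  rewrite dE ler_wpM2l //.
  have : (Num.truncn s)%:R <= s by rewrite truncn_le // ltW.
  by rewrite -natr1; lra.
have lM : 4 * l%:R * l.+1%:R * M%:R <= A * eps * n%:R ^+ 2.
  apply: (@le_trans _ _ (4 * l%:R * (2 * l%:R) *
      (4 * l%:R ^+ 3 * eps * n%:R ^+ 2))).
    rewrite ler_pM ?mulr_ge0 ?ler0n // ler_wpM2l ?mulr_ge0 //.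
    by rewrite -natr1; lra.
  by apply: eqle; rewrite /A; ring.
have [||U [b [e [bn ed cU Upart]]]] := struct d.
- rewrite -(ler_nat R) 3!natrM 2!natrX.
  have : 4 * l%:R * (4 * l%:R * l.+1%:R * M%:R) <=
      4 * l%:R * (A * eps * n%:R ^+ 2) by rewrite ler_wpM2l ?mulr_ge0.
  have : 128 * l%:R ^+ 6 * eps * n%:R ^+ 2 <= n%:R ^+ 2.
    rewrite ger_pMl ?exprn_gt0 //.
    by apply: eps_pow; rewrite ?ler_nat.
  by rewrite /A; lra.
- rewrite -(ler_nat R) 4!natrM; apply: le_trans lM _.
  rewrite expr2 mulrA ler_wpM2r // -mulrA; apply: le_trans dge.
  by rewrite ler_wpM2l.
have bR : b%:R <= A * (eps * n%:R).
  rewrite -(ler_pM2r n0R); move: bn; rewrite -(ler_nat R) 4!natrM => /le_trans.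
  by apply; apply: le_trans lM _; apply: eqle; ring.
have y1 : 1 <= s ^+ l.-1 by apply: exprn_ege1.
have sy : s ^+ l.-1 * s = n%:R by rewrite -exprSr prednK.
have en0 : 0 <= eps * n%:R by rewrite mulr_ge0.
have eR : e%:R <= 4 * l%:R ^+ 3 * (eps * n%:R) * s ^+ l.-1.
  rewrite -(ler_pM2r s0) -[leRHS]mulrA sy.
  have A1 : 1 <= A.
    have : 1 <= l%:R ^+ 5 :> R by apply: exprn_ege1.
    by rewrite /A; lra.
  have sd : s <= d.+1%:R.
    apply: le_trans (le_trans dge _); last by rewrite ler_nat.
    by rewrite ler_peMl // ltW.
  apply: (@le_trans _ _ (e%:R * d.+1%:R)); first by rewrite ler_wpM2l.
  move: ed; rewrite -(ler_nat R) natrM => /le_trans; apply.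
  by apply: le_trans MleR _; apply: eqle; ring.
have UR : #|~: U|%:R <= C0 * (eps * n%:R) * s ^+ l.-1.
  move: cU; rewrite -(ler_nat R) 2!natrD 2!natrM natrX natrM natrX.
  move/le_trans; apply.
  rewrite /C0 2!(mulrDl _ _ (eps * n%:R)) 2!(mulrDl _ _ (s ^+ l.-1)).
  apply: lerD; first apply: lerD => //.
    by apply: le_trans bR _; rewrite ler_peMr // mulr_ge0.
  apply: (@le_trans _ _ (l%:R ^+ 2 * (A * (eps * n%:R)) *
     ((cover_const (l - 2))%:R * (2 * A * s) ^+ l.-1))).
    rewrite ler_pM ?mulr_ge0 ?exprn_ge0 ?ler0n // ler_wpM2l ?exprn_ge0 ?ler0n //.
    by rewrite lerXn2r // ?nnegrE ?mulr_ge0 // ltW.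
  by rewrite [(2 * A * s) ^+ _]exprMn; apply: eqle; ring.
have y0 : 0 <= s ^+ l.-1 by lra.
set y := s ^+ l.-1 in y0 small UR *.
have z0 : 0 <= eps * y by rewrite mulr_ge0.
exists U; split; last first.
  apply: Upart; rewrite -(ler_nat R) !natrM.
  apply: (@le_trans _ _ (2 * l%:R * (C0 * (eps * n%:R) * y))).
    by rewrite ler_wpM2l ?mulr_ge0.
  have -> : 2 * l%:R * (C0 * (eps * n%:R) * y) =
    2 * l%:R * C0 * eps * y * n%:R by ring.
  by rewrite ger_pMl //; lra.
have UC : #|U|%:R = n%:R - #|~: U|%:R :> R.
  by rewrite -cV -(cardsC U) natrD addrK.
rewrite UC; set J := big * _ * _ * eps in junk0 *; clearbody J y C0.
have : C0 * (eps * n%:R) * y <= (2 * l%:R * C0 + 1) * eps * y * n%:R.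
  have -> : C0 * (eps * n%:R) * y = C0 * eps * y * n%:R by ring.
  rewrite ler_wpM2r // -!mulrA; have : 0 <= C0 * (eps * y) * (2 * l%:R - 1).
    by rewrite !mulr_ge0 //; lra.
  by lra.
have : 0 <= J * n%:R by rewrite mulr_ge0.
by lra.
Qed.
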